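(* Let $\alpha$ be real with $1\le\alpha<\infty$, and let $f$ be a log-concave probability density function on $\mathbb{R}$ with finite $\sigma_\alpha$. Put $C_\alpha=\frac{2}{\alpha}\Gamma\left(\frac{1}{\alpha}\right)(\alpha e)^{1/\alpha}$ and $D_\alpha=\Gamma(\alpha+1)^{1/\alpha}$. Then for all $1\le p\le\infty$ and $1\le q\le\infty$, $$C_\alpha^{\frac1p-1}\,D_\alpha^{\frac1q-1}\,\sigma_\alpha^{\frac1p-\frac1q}\,\|f\|_q\le\|f\|_p\le C_\alpha^{1-\frac1q}\,D_\alpha^{1-\frac1p}\,\sigma_\alpha^{\frac1p-\frac1q}\,\|f\|_q .$$ In particular (case $q=1$, where $\|f\|_1=1$), for all $1\le p\le\infty$, $$(C_\alpha\sigma_\alpha)^{\frac1p-1}\le\|f\|_p\le\left(\frac{\sigma_\alpha}{D_\alpha}\right)^{\frac1p-1}.$$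
   Context: A probability density function (pdf, with respect to Lebesgue measure) $f:\mathbb{R}^n\to\mathbb{R}$ is log-concave if $f(\theta x+(1-\theta)y)\ge f(x)^\theta f(y)^{1-\theta}$ for all $x,y\in\mathbb{R}^n$ and $0\le\theta\le1$; here $n=1$. For $1\le p<\infty$, $\|f\|_p=\left(\int_{\mathbb{R}} f(x)^p\,dx\right)^{1/p}$, and $\|f\|_\infty=\operatorname{ess\,sup}_{x\in\mathbb{R}}|f(x)|$ (Lebesgue measure). Convention: $1/\infty=0$. For a random variable $X$ with pdf $f$, $\sigma_\alpha=\left(E\left[|X-E[X]|^\alpha\right]\right)^{1/\alpha}$. $\Gamma$ is the gamma function. *)

(* Defs.v *)
From HB Require Import structures.
From mathcomp Require Export all_boot all_order all_algebra.
From mathcomp Require Export all_classical all_reals all_analysis.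
Export Order.TTheory GRing.Theory Num.Theory.
Export numFieldNormedType.Exports.

Set Implicit Arguments.
Unset Strict Implicit.
Unset Printing Implicit Defensive.

Local Open Scope classical_set_scope.
Local Open Scope ring_scope.

Definition log_concave (R : realType) (f : R -> R) : Prop :=
  forall x y theta : R, 0 <= theta <= 1 ->
    f x `^ theta * f y `^ (1 - theta) <= f (theta * x + (1 - theta) * y).

Definition is_pdf (R : realType) (f : R -> R) : Prop :=
  [/\ measurable_fun [set: R] f, forall x, 0 <= f x &
      (\int[lebesgue_measure]_x (f x)%:E = 1)%E].

Definition has_pdf (R : realType) (d : measure_display) (T : measurableType d)
    (P : probability T R) (X : {RV P >-> R}) (f : R -> R) : Prop :=
  is_pdf f /\
  forall A : set R, measurable A ->
    (distribution P X A = \int[lebesgue_measure]_(x in A) (f x)%:E)%E.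

(* Extended-real valued, so that finiteness of the central moment is a genuine
   hypothesis. *)
Definition sigma (R : realType) (d : measure_display) (T : measurableType d)
    (P : probability T R) (X : {RV P >-> R}) (alpha : R) : \bar R :=
  ('E_P[(fun w => `|X w - fine 'E_P[X]| `^ alpha)%R] `^ alpha^-1)%E.

(* Euler's integral, meaningful for 0 < z. *)
Definition Gamma (R : realType) (z : R) : R :=
  \int[lebesgue_measure]_(t in `]0, +oo[) (t `^ (z - 1) * expR (- t)).

Definition constC (R : realType) (alpha : R) : R :=
  2 / alpha * Gamma alpha^-1 * (alpha * expR 1) `^ alpha^-1.

Definition constD (R : realType) (alpha : R) : R :=
  Gamma (alpha + 1) `^ alpha^-1.

(* Lnorm at +oo is the essential supremum of |f|, Lebesgue measure being
   nonzero. *)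
Definition Lp_norm (R : realType) (p : \bar R) (f : R -> R) : \bar R :=
  Lnorm (@lebesgue_measure R) p (EFin \o f).

(* The real number 1/p, with 1/oo = 0 coming from (+oo)^-1 = 0 in \bar R. *)
Definition recip (R : realType) (p : \bar R) : R := fine (p^-1)%E.

(* Main.v *)
(* Lower bound: with w = |x - mu|^a / (a s^a), the density exp (- w) up to a
   constant is the maximal entropy density of a-th central moment s^a, and
   convexity of y |-> y^p against it gives ||f||_p >= (C s)^(1/p - 1); this needs
   no log-concavity. Upper bound: f <= D / s pointwise, whence
   ||f||_p <= (D / s)^(1 - 1/p). To see it, take x0 with f x0 within a factor
   11/10 of sup f. On each side of x0, log-concavity makes f cross the
   exponential density of the same value at x0 and the same mass only once, so
   that increasing functions integrate less against f; together with the
   position of the mean this bounds the a-th central moment by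
   Gamma (a + 1) / (f x0)^a. The corollary is the product of the two bounds. *)
From HB Require Import structures.
From mathcomp Require Import measurable_realfun ess_sup_inf ring lra.
Require Import Defs.
Set Implicit Arguments.
Unset Strict Implicit.
Unset Printing Implicit Defensive.
Local Open Scope classical_set_scope.
Local Open Scope ring_scope.

(** No semicontinuity of [f] is assumed, so its supremum may be missed; hence an approximate
    maximizer. The factor 11/10 does not reach the final constant: the moment estimate involves the
    value [f x0] itself, and [x0] is chosen anew for each point x, with [f x <= f x0]. The factor
    enters only between [x0] and the mean. There the distance to the mean shrinks as one moves away
    from [x0], so the weight is not increasing, the crossing argument is silent, and the crude bound
    [f x <= 11 / 10 * f x0] replaces it. The loss is paid for beyond the mean, where the comparison
    exponential gains a factor exp(-s), s being the distance from [x0] to the mean in the length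
    scale of that exponential. What has to be checked is exp(-s) + (11/20) s^2 <= 1, with 11/20 half
    of 11/10. This holds up to s = 1, and the crossing argument for the weight u keeps s below the
    mass on that side, hence below 1. *)

(** * Affine substitutions in Lebesgue integrals *)

Section change_of_variables.
Context {R : realType}.
Local Notation mu := (@lebesgue_measure R).
Local Open Scope ereal_scope.

Let affine (a b : R) (x : measurableTypeR R) : measurableTypeR R := (a * x + b)%R.

Let measurable_affine (a b : R) : measurable_fun setT (affine a b).
Proof. by apply: measurable_funD => //; apply: measurable_funM. Qed.

(** The pushforward of [mu] along the affine map, scaled by [a], gives half-open intervals their
    length, and Lebesgue measure is the only measure doing so. *)
Lemma lebesgue_measure_affine (a b : R) (A : set R) : (0 < a)%R -> measurable A ->
  a%:E * mu ((fun x => a * x + b)%R @^-1` A) = mu A.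
Proof.
move=> a0 mA.
pose a' : {nonneg R} := NngNum (ltW a0).
pose nu' := mscale a' (pushforward mu (affine a b)).
pose nu := nu' (measurable_affine a b).
suff -> : mu A = nu A by [].
apply: (lebesgue_measure_unique (mu := nu)) => //= _ [[u v]] _ <-.
rewrite /nu /mscale/= /pushforward.
have -> : ((fun x => a * x + b)%R @^-1` `]u, v]%classic) =
   `]((u - b) / a)%R, ((v - b) / a)%R]%classic.
  apply/seteqP; split=> x /=; rewrite !in_itv/= ltr_pdivrMr// ler_pdivlMr// (mulrC x) ltrBlDr lerBrDr//.
rewrite !lebesgue_measure_itv/= !lte_fin ltr_pM2r ?invr_gt0// ltrD2r.
case: ifPn => _; last by rewrite mule0.
by rewrite -EFinD -EFinM; congr EFin; field; rewrite gt_eqF.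
Qed.

Lemma ge0_integral_affine (a b : R) (D : set R) (f : R -> \bar R) : (0 < a)%R ->
  measurable D -> measurable_fun D f -> (forall x, D x -> 0 <= f x) ->
  \int[mu]_(x in D) f x = a%:E *
    \int[mu]_(x in (fun x => a * x + b)%R @^-1` D) f (a * x + b)%R.
Proof.
move=> a0 mD mf f0.
pose a' : {nonneg R} := NngNum (ltW a0).
pose nu' := mscale a' (pushforward mu (affine a b)).
pose nu := nu' (measurable_affine a b).
transitivity (\int[nu]_(x in D) f x).
  apply: eq_measure_integral => //= A mA AD; rewrite /nu /mscale/= /pushforward.
  by rewrite lebesgue_measure_affine.
rewrite ge0_integral_mscale//= ge0_integral_pushforward//.
by move=> x /set_mem; exact: f0.
Qed.

Lemma ge0_integral_scale (a : R) (f : R -> \bar R) : (0 < a)%R ->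
  measurable_fun [set: R] f -> (forall x, (0 <= x)%R -> 0 <= f x) ->
  \int[mu]_(x in `[0%R, +oo[) f x = a%:E * \int[mu]_(x in `[0%R, +oo[) f (a * x)%R.
Proof.
move=> a0 mf f0; rewrite (@ge0_integral_affine a 0%R)//; last 2 first.
  exact: measurable_funTS.
  by move=> x /=; rewrite in_itv/= andbT => /f0.
congr (_ * _); under eq_integral do rewrite addr0.
congr integral; apply/seteqP; split=> x /=; rewrite !in_itv/= !andbT addr0 pmulr_rge0//.
Qed.

Lemma ge0_integral_shift (m : R) (f : R -> \bar R) :
  measurable_fun [set: R] f -> (forall x, (m <= x)%R -> 0 <= f x) ->
  \int[mu]_(x in `[m, +oo[) f x = \int[mu]_(x in `[0%R, +oo[) f (x + m)%R.
Proof.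
move=> mf f0; rewrite (@ge0_integral_affine 1 m)//; last 2 first.
  exact: measurable_funTS.
  by move=> x /=; rewrite in_itv/= andbT => /f0.
rewrite mul1e; under eq_integral do rewrite mul1r.
congr integral; apply/seteqP; split=> x /=; rewrite !in_itv/= !andbT mul1r; lra.
Qed.

(** Folds the line at [c], so that both sides of a point are studied on the same half-line [[0,
    +oo[]. *)
Lemma ge0_integral_setT_split (c : R) (f : R -> \bar R) :
  measurable_fun setT f -> (forall x, 0 <= f x) ->
  \int[mu]_x f x = \int[mu]_(u in `[0%R, +oo[) f (c + u)%R +
                   \int[mu]_(u in `[0%R, +oo[) f (c - u)%R.
Proof.
move=> mf f0.
have mfc : measurable_fun setT (fun x : R => f (c - x)%R).
  apply: measurableT_comp => //; exact: measurable_funB.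
rewrite [X in _ + X]ge0_integration_by_substitution0//.
under [X in _ + X]eq_integral do rewrite opprK.
have -> : \int[mu]_x f x = \int[mu]_x f (c + x)%R.
  rewrite (@ge0_integral_affine 1 c)// mul1e preimage_setT.
  by apply: eq_integral => x _; rewrite mul1r addrC.
have mfc' : measurable_fun setT (fun x : R => f (c + x)%R).
  apply: measurableT_comp => //; exact: measurable_funD.
(* The point 0 is dropped from one half so that the two halves are complementary. *)
rewrite -(@integral_itv_obnd_cbnd _ 0%R +oo%O)//.
- rewrite -[X in integral _ X _](setUv `]0%R, +oo[%classic) ge0_integral_setU//=.
  + by congr (_ + _); rewrite setCitvr.
  + exact: measurableC.
  + by rewrite setUv.
  + exact/disj_setPCl.
- exact: measurable_funS mfc'.
Qed.

End change_of_variables.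

(** * Gamma integrals at positive exponents *)

Section gamma_integrals.
Context {R : realType}.
Local Notation mu := (@lebesgue_measure R).

Lemma cvg_expR_oppM (c : R) : 0 < c -> expR (- (x * c)) @[x --> +oo%R] --> (0 : R).
Proof.
move=> c0; apply: (@cvg_comp _ _ _ (fun x => x * c) (fun x => expR (- x)) _ (pinfty_nbhs R)).
  exact: gt0_cvgMly.
exact: cvgr_expR.
Qed.

Lemma integral_expRN : (\int[mu]_(u in `[0%R, +oo[) (expR (- u))%:E = 1)%E.
Proof.
rewrite (@ge0_continuous_FTC2y _ _ (fun u => - expR (- u)) _ 0).
- by rewrite oppr0 expR0 EFinN oppeK add0e.
- by move=> x _; exact: expR_ge0.
- apply: continuous_subspaceT => x.
  by apply: continuous_comp; [exact: continuousN|exact: continuous_expR].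
- by rewrite -oppr0; apply: cvgN; exact: cvgr_expR.
- by move=> x _; apply: ex_derive.
- apply: cvg_at_right_filter; apply: cvgN.
  by apply: continuous_comp; [exact: continuousN|exact: continuous_expR].
- move=> x _; rewrite derive1E derive_val; ring.
Qed.

Lemma integral_id_expRN : (\int[mu]_(u in `[0%R, +oo[) (u * expR (- u))%:E = 1)%E.
Proof.
have cF : continuous (fun u : R => (u + 1) * expR (- u)).
  move=> x; apply: cvgM; first by apply: cvgD => //; exact: cvg_cst.
  by apply: continuous_comp; [exact: continuousN|exact: continuous_expR].
rewrite (@ge0_continuous_FTC2y _ _ (fun u => - ((u + 1) * expR (- u))) _ 0).
- by rewrite oppr0 expR0 EFinN oppeK !add0e add0r mulr1.
- by move=> x x0; rewrite mulr_ge0// expR_ge0.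
- apply: continuous_subspaceT => x; apply: cvgM => //.
  by apply: continuous_comp; [exact: continuousN|exact: continuous_expR].
- rewrite -oppr0; apply: cvgN.
  (* Half of the decay absorbs the linear factor: [u + 1 <= 2 * expR (u / 2)]. *)
  apply: (@squeeze_cvgr _ _ _ _ (cst 0) (fun u => 2 * expR (- (u * 2^-1)))).
  + near=> u.
    have u0 : 0 <= u by [].
    apply/andP; split; first by rewrite mulr_ge0 ?expR_ge0// addr_ge0.
    have -> : expR (- u) = expR (- (u * 2^-1)) * expR (- (u * 2^-1)).
      by rewrite -expRD; congr expR; field.
    rewrite mulrA ler_pM2r ?expR_gt0// expRN ler_pdivrMr ?expR_gt0//.
    have := expR_ge1Dx (u * 2^-1); lra.
  + exact: cvg_cst.
  + rewrite -(mulr0 2); apply: cvgMr; exact: cvg_expR_oppM.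
- by move=> x _; apply: ex_derive.
- by apply: cvg_at_right_filter; apply: cvgN; exact: cF.
- move=> x _; rewrite derive1E derive_val /GRing.scale/=; ring.
Unshelve. all: by end_near. Qed.

Lemma measurable_powR_expRN (a : R) :
  measurable_fun [set: R] (fun u => u `^ a * expR (- u)).
Proof.
apply: measurable_funM; first exact: measurable_powR.
by apply: measurableT_comp.
Qed.

(** Amounts to [ln t < t] at t = u / (2 a). Only half of the exponential is spent on the power; the
    other half keeps the Gamma integral finite. *)
Lemma powR_le_expR (a u : R) : 0 < a -> 0 <= u ->
  u `^ a <= (2 * a) `^ a * expR (u / 2).
Proof.
move=> a0; rewrite le_eqVlt => /predU1P[<-|u0].
  by rewrite powR0 ?gt_eqF// mulr_ge0 ?powR_ge0 ?expR_ge0.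
rewrite /powR !gt_eqF ?mulr_gt0// -expRD ler_expR -lerBlDl -mulrBr.
rewrite -ler_pdivlMl//.
rewrite -ln_div ?posrE ?mulr_gt0//.
have -> : a^-1 * (u / 2) = u / (2 * a) by field; rewrite gt_eqF.
by apply/ltW/ln_sublinear; rewrite divr_gt0 ?mulr_gt0.
Qed.

(** [Gamma] is a real integral, where an infinite value would be lost under [fine]; the content is
    therefore finiteness, by comparison with a multiple of exp(-u/2). *)
Lemma integral_powR_expRN (a : R) : 0 < a ->
  (\int[mu]_(u in `[0%R, +oo[) (u `^ a * expR (- u))%:E = (Gamma (a + 1))%:E)%E.
Proof.
move=> a0; rewrite /Gamma addrK /Rintegral.
rewrite integral_itv_obnd_cbnd; last first.
  by apply/measurable_EFinP/measurable_funTS; exact: measurable_powR_expRN.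
rewrite fineK// ge0_fin_numE; last first.
  by apply: integral_ge0 => u _; rewrite lee_fin mulr_ge0 ?powR_ge0 ?expR_ge0.
have mE : measurable_fun [set: R] (fun u => expR (- u)) by apply: measurableT_comp.
apply: (@le_lt_trans _ _
  (\int[mu]_(u in `[0%R, +oo[) ((2 * a) `^ a * expR (- (2^-1 * u)))%:E)%E).
  apply: ge0_le_integral => //.
  - by move=> u _; rewrite lee_fin mulr_ge0 ?powR_ge0 ?expR_ge0.
  - apply/measurable_funTS/measurable_EFinP; exact: measurable_powR_expRN.
  - apply/measurable_funTS/measurable_EFinP/measurable_funM => //.
    by do 2 apply: measurableT_comp => //; apply: measurable_funM.
  - move=> u /=; rewrite in_itv/= andbT => u0; rewrite lee_fin.
    have -> : expR (- (2^-1 * u)) = expR (u / 2) * expR (- u).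
      by rewrite -expRD; congr expR; field.
    by rewrite mulrA ler_wpM2r ?expR_ge0// powR_le_expR.
under eq_integral do rewrite EFinM.
rewrite ge0_integralZl//=; last 2 first.
- apply/measurable_funTS/measurable_EFinP.
  by do 2 apply: measurableT_comp => //; apply: measurable_funM.
- by rewrite lee_fin powR_ge0.
apply: lte_mul_pinfty; rewrite ?lee_fin ?powR_ge0//.
(* Rescaling makes 1 half of the dominating integral, which therefore cannot be infinite. *)
have : (1 = 2^-1%:E * \int[mu]_(x in `[0%R, +oo[) (expR (- (2^-1 * x)))%:E)%E.
  rewrite -integral_expRN (@ge0_integral_scale R 2^-1 (fun u => (expR (- u))%:E))//.
  by exact/measurable_EFinP.
rewrite ltey; apply: contraPN => /eqP ->.
by rewrite gt0_muley ?lte_fin ?invr_gt0.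
Qed.

(** Bernoulli's inequality, from Young's inequality for u and 1 with exponents a and a / (a - 1).
    The case a = 1, without finite conjugate exponent, is separate. *)
Lemma powR_ge_tangent (a u : R) : 1 <= a -> 0 <= u -> 1 + a * (u - 1) <= u `^ a.
Proof.
move=> a1; rewrite le_eqVlt => /predU1P[<-|u0].
  by rewrite powR0; lra.
move: a1; rewrite le_eqVlt => /predU1P[<-|a1]; first by rewrite (powRr1 (ltW u0)); lra.
have a0 : 0 < a by lra.
have := @conjugate_powR R u 1 a (a / (a - 1)) (ltW u0) ler01 a0.
rewrite powR1 mulr1.
have an0 : a != 0 by rewrite gt_eqF.
have an1 : a - 1 != 0 by rewrite gt_eqF// subr_gt0.
have -> : a^-1 + (a / (a - 1))^-1 = 1 by field; rewrite ?an0 ?an1.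
have -> : u `^ a / a + 1 / (a / (a - 1)) = (u `^ a + a - 1) / a.
  by field; rewrite ?an0 ?an1.
rewrite ler_pdivlMr// => H.
have : u * a <= u `^ a + a - 1 by apply: H => //; rewrite divr_gt0// ?subr_gt0.
lra.
Qed.

(** Bernoulli's inequality u^a >= 1 + a (u - 1) integrated against exp(-u), for which 1 and u both
    have integral 1. The constant a - 1 is moved across to keep the integrands nonnegative. *)
Lemma Gamma_ge1 (a : R) : 1 <= a -> 1 <= Gamma (a + 1).
Proof.
move=> a1; have a0 : 0 < a by lra.
rewrite -lee_fin -integral_powR_expRN//.
have mE : measurable_fun [set: R] (fun u => expR (- u)) by apply: measurableT_comp.
rewrite -(@leeD2rE _ ((a - 1)%:E)%E)// -EFinD addrCA subrr addr0.
rewrite -[X in (_ <= _ + X)%E](mule1) -integral_expRN -ge0_integralZl//; last 2 first.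
- exact/measurable_funTS/measurable_EFinP.
- by rewrite lee_fin subr_ge0.
rewrite -ge0_integralD//; last 4 first.
- by move=> x _; rewrite lee_fin mulr_ge0 ?powR_ge0 ?expR_ge0.
- apply/measurable_funTS/measurable_EFinP; exact: measurable_powR_expRN.
- by move=> x _; rewrite lee_fin mulr_ge0 ?expR_ge0 ?subr_ge0.
- by apply/measurable_funTS/measurable_EFinP/measurable_funM.
rewrite -[X in (X <= _)%E](mule1) -integral_id_expRN -ge0_integralZl//; last 3 first.
- by apply/measurable_funTS/measurable_EFinP/measurable_funM.
- by move=> x/=; rewrite in_itv/= andbT => x0; rewrite lee_fin mulr_ge0 ?expR_ge0.
- by rewrite lee_fin ltW.
apply: ge0_le_integral => //.
- move=> x/=; rewrite in_itv/= andbT => x0; rewrite lee_fin !mulr_ge0 ?expR_ge0//; exact: ltW.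
- by apply/measurable_funTS/measurable_EFinP/measurable_funM => //; apply: measurable_funM.
- apply/measurable_funTS/measurable_EFinP/measurable_funD.
    exact: measurable_powR_expRN.
  exact: measurable_funM.
- move=> x/=; rewrite in_itv/= andbT => x0; rewrite -EFinM -EFinD lee_fin.
  rewrite mulrA -mulrDl ler_wpM2r ?expR_ge0//.
  have := powR_ge_tangent a1 x0; lra.
Qed.

End gamma_integrals.

(** * The integral of exp(-y^a) as a Gamma value *)

Section power_substitution.
Context {R : realType}.
Local Notation mu := (@lebesgue_measure R).

Lemma powRK (a x : R) : a != 0 -> 0 <= x -> (x `^ a) `^ a^-1 = x.
Proof. by move=> a0 x0; rewrite -powRrM mulfV// powRr1. Qed.

Lemma powRVK (a x : R) : a != 0 -> 0 <= x -> (x `^ a^-1) `^ a = x.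
Proof. by move=> a0 x0; rewrite -powRrM mulVf// powRr1. Qed.

Lemma cvgry_powR (c : R) : 0 < c -> x `^ c @[x --> +oo%R] --> +oo%R.
Proof.
move=> c0; apply/cvgryPge => A; near=> x.
have Ax : `|A| `^ c^-1 <= x by near: x; apply: nbhs_pinfty_ge; rewrite num_real.
rewrite (le_trans (ler_norm A))// -(@powRVK c `|A|) ?gt_eqF//.
by apply: ge0_ler_powR; rewrite ?nnegrE ?powR_ge0 ?(ltW c0)// (le_trans _ Ax)// powR_ge0.
Unshelve. all: by end_near. Qed.

Lemma cvgr0_powRN (c : R) : 0 < c -> x `^ (- c) @[x --> +oo%R] --> (0 : R).
Proof.
move=> c0; under eq_fun do rewrite powRN.
by apply/gtr0_cvgV0; [near=> x; apply: powR_gt0|exact: cvgry_powR].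
Unshelve. all: by end_near. Qed.

Lemma continuous_at_powR (c x : R) : 0 < x -> {for x, continuous (@powR R ^~ c)}.
Proof.
move=> x0; apply/differentiable_continuous/derivable1_diffP.
by apply: derivable_powR; rewrite in_itv/= x0.
Qed.

(** Substitution y = t^(1/a), cut off at e > 0 because for a > 1 its derivative blows up at 0. *)
Lemma integral_expR_powR_tail (a e : R) : 1 <= a -> 0 < e ->
  (\int[mu]_(y in `[(e `^ a^-1)%R, +oo[) (expR (- (y `^ a)))%:E =
   \int[mu]_(t in `[e, +oo[) (a^-1 * (t `^ (a^-1 - 1) * expR (- t)))%:E)%E.
Proof.
move=> a1 e0; have a0 : 0 < a by lra.
pose F (t : R) := t `^ a^-1.
have dFE (x : R) : 0 < x -> F^`()%classic x = a^-1 * x `^ (a^-1 - 1).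
  by move=> x0; rewrite /F powR_derive1// in_itv/= x0.
have near_dF (x : R) : 0 < x -> \forall t \near x, a^-1 * t `^ (a^-1 - 1) = F^`()%classic t.
  by move=> x0; near=> t; rewrite dFE//; near: t; exact: lt_nbhsr.
have cpow (x : R) : 0 < x -> {for x, continuous (fun t => a^-1 * t `^ (a^-1 - 1))}.
  by move=> x0; apply: cvgMr; exact: continuous_at_powR.
have cdF (x : R) : 0 < x -> {for x, continuous F^`()%classic}.
  move=> x0; rewrite /prop_for /continuous_at dFE//.
  by apply: cvg_trans (cpow _ x0); apply: near_eq_cvg; exact: near_dF.
have Fe0 : 0 < F e by exact: powR_gt0.
rewrite -[_ `^ _]/(F e) (@increasing_ge0_integration_by_substitutiony _ F).
- apply: eq_integral => t /[!inE]/=; rewrite in_itv/= andbT => et.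
  have t0 : 0 < t by apply: lt_le_trans et.
  rewrite /= fctE/= dFE// /F powRVK ?gt_eqF//; last exact: ltW.
  by congr EFin; ring.
- move=> x y /[!in_itv]/= /[!andbT] ex ey xy.
  by apply: gt0_ltr_powR; rewrite ?invr_gt0 ?nnegrE//; lra.
- move=> x; rewrite in_itv/= andbT => ex; apply: cdF; lra.
- by apply/cvg_ex; exists (F^`()%classic e); apply: cvg_at_right_filter; exact: cdF.
- have near_dFy : \forall t \near +oo, a^-1 * t `^ (a^-1 - 1) = F^`()%classic t.
    by near=> t; rewrite dFE//; near: t; exact: nbhs_pinfty_gt.
  (* The substitution rule asks for a limit of the derivative at infinity: it is constantly 1 for a
     = 1 and tends to 0 for a > 1. *)
  move: a1; rewrite le_eqVlt => /predU1P[a1|a1].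
    apply/cvg_ex; exists (1 : R).
    have H : \forall t \near +oo, (cst 1 : R -> R) t = F^`()%classic t.
      near=> t; rewrite -(near near_dFy t)//.
      by rewrite -a1 invr1 subrr powRr0 mulr1.
    by apply: (cvg_trans (near_eq_cvg H)); exact: cvg_cst.
  apply/cvg_ex; exists (a^-1 * 0).
  have : a^-1 * t `^ (a^-1 - 1) @[t --> +oo%R] --> a^-1 * 0.
    rewrite -opprB; apply: cvgMr; apply: cvgr0_powRN.
    by rewrite subr_gt0 invf_lt1.
  by apply: cvg_trans; apply: near_eq_cvg.
- split.
  + by move=> x; rewrite in_itv/= andbT => ex; apply: derivable_powR; rewrite in_itv/= andbT; lra.
  + apply: cvg_at_right_filter; exact: continuous_at_powR.
- by apply: cvgry_powR; rewrite invr_gt0.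
- apply: continuous_in_subspaceT => y; rewrite inE/= in_itv/= andbT => Fy.
  apply: continuous_comp; last exact: continuous_expR.
  apply: cvgN; apply: continuous_at_powR; lra.
- by move=> x _; exact: expR_ge0.
Unshelve. all: by end_near. Qed.

(** Removes the cut-off: the half-lines increase to []0, +oo[], and the point 0 is negligible. *)
Lemma cvg_integral_tail (u : R^nat) (f : R -> R) : nonincreasing_seq u ->
  (forall n, 0 < u n) -> u @ \oo --> (0 : R) ->
  measurable_fun [set: R] f -> (forall x, 0 <= f x) ->
  (\int[mu]_(x in `[u n, +oo[) (f x)%:E @[n --> \oo] -->
    \int[mu]_(x in `[0%R, +oo[) (f x)%:E)%E.
Proof.
move=> du u0 ucv mf f0.
rewrite -integral_itv_obnd_cbnd; last first.
  by apply/measurable_EFinP/measurable_funTS.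
have -> : `]0%R, +oo[%classic = \bigcup_n `[u n, +oo[%classic :> set R.
  apply/seteqP; split=> x /=; rewrite !in_itv/= andbT.
    move=> x0; have : \forall n \near \oo, u n < x by exact: (cvgr_lt (0 : R)).
    by move=> [n _ /(_ n (leqnn n)) unx]; exists n => //=; rewrite in_itv/= andbT ltW.
  by move=> [n _ /=]; rewrite in_itv/= andbT; exact: lt_le_trans.
apply: ge0_nondecreasing_set_cvg_integral => //.
- apply/nondecreasing_seqP => n; rewrite subsetEset => x /=.
  by rewrite !in_itv/= !andbT; apply: le_trans; apply: du.
- by move=> i; apply/measurable_EFinP/measurable_funTS.
- by move=> i x _; rewrite lee_fin.
Qed.

Lemma measurable_expR_powR (a : R) : measurable_fun [set: R] (fun y => expR (- (y `^ a))).
Proof. by do 2 apply: measurableT_comp => //; exact: measurable_powR. Qed.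

(** Both sides are limits of the cut-off identity along e = 1 / (n + 1). Extended reals are kept
    because finiteness is not yet known. *)
Lemma integral_expR_powR_ereal (a : R) : 1 <= a ->
  (\int[mu]_(y in `[0%R, +oo[) (expR (- (y `^ a)))%:E =
   \int[mu]_(t in `[0%R, +oo[) (a^-1 * (t `^ (a^-1 - 1) * expR (- t)))%:E)%E.
Proof.
move=> a1; have a0 : 0 < a by lra.
have m1 : measurable_fun [set: R] (fun y => expR (- (y `^ a))).
  by do 2 apply: measurableT_comp => //; exact: measurable_powR.
have m2 : measurable_fun [set: R] (fun t => a^-1 * (t `^ (a^-1 - 1) * expR (- t))).
  by apply: measurable_funM => //; exact: measurable_powR_expRN.
have h0 (n : nat) : (0 : R) < n.+1%:R^-1 by [].
have hd : nonincreasing_seq (fun n => n.+1%:R^-1 : R).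
  by move=> m n mn; rewrite lef_pV2 ?posrE// ler_nat.
have H1 := @cvg_integral_tail _ _ hd h0 (@cvg_harmonic R) m2 _.
have H2 := @cvg_integral_tail (fun n => n.+1%:R^-1 `^ a^-1) _ _ _ _ m1 (fun x => expR_ge0 _).
apply/esym; apply: (cvg_unique _ (H1 _)) => //.
  by move=> x; rewrite !mulr_ge0 ?powR_ge0 ?expR_ge0 ?invr_ge0//; exact: ltW.
rewrite /=; under eq_fun do rewrite -integral_expR_powR_tail//.
apply: H2.
- move=> m n mn; apply: ge0_ler_powR; rewrite ?nnegrE ?invr_ge0 ?(ltW a0)//; exact: hd.
- by move=> n; exact: powR_gt0.
- have -> : (fun n => n.+1%:R^-1 `^ a^-1) = (fun x : R => x `^ (- a^-1)) \o (fun n => n.+1%:R : R).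
    by apply/funext => n /=; rewrite powRN -powR_inv1// -powRrM mulN1r powRN.
  apply: (@cvg_comp _ _ _ _ _ _ (pinfty_nbhs R)).
    by have := @cvgr_idn R; rewrite -cvg_shiftS.
  by apply: cvgr0_powRN; rewrite invr_gt0.
Qed.

(** The Gamma integrand now has exponent 1/a - 1 <= 0, outside the range of [integral_powR_expRN].
    Its integral is finite because the left side is: y <= y^a + 1 bounds exp(-y^a) by e exp(-y). *)
Lemma integral_expR_powR (a : R) : 1 <= a ->
  (\int[mu]_(y in `[0%R, +oo[) (expR (- (y `^ a)))%:E = (a^-1 * Gamma a^-1)%:E)%E.
Proof.
move=> a1; have a0 : 0 < a by lra.
have := integral_expR_powR_ereal a1.
have mf := @measurable_powR_expRN R (a^-1 - 1).
under [RHS]eq_integral do rewrite EFinM.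
have If0 : (0 <= \int[mu]_(x in `[0%R, +oo[) (x `^ (a^-1 - 1) * expR (- x))%:E)%E.
  by apply: integral_ge0 => x _; rewrite lee_fin mulr_ge0 ?powR_ge0 ?expR_ge0.
rewrite ge0_integralZl//=; last 3 first.
- exact/measurable_EFinP/measurable_funTS.
- by move=> x _; rewrite lee_fin mulr_ge0 ?powR_ge0 ?expR_ge0.
- by rewrite lee_fin invr_ge0 ltW.
move=> H; rewrite H; rewrite /Gamma /Rintegral integral_itv_obnd_cbnd; last first.
  exact/measurable_EFinP/measurable_funTS.
rewrite EFinM fineK// ge0_fin_numE//.
suff : (\int[mu]_(y in `[0%R, +oo[) (expR (- (y `^ a)))%:E < +oo)%E.
  rewrite H !ltey; apply: contraNN => /eqP ->.
  by rewrite gt0_muley ?lte_fin ?invr_gt0.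
apply: (@le_lt_trans _ _ (\int[mu]_(y in `[0%R, +oo[) (expR 1 * expR (- y))%:E)%E).
  apply: ge0_le_integral => //.
  - by apply/measurable_EFinP/measurable_funTS; exact: measurable_expR_powR.
  - by apply/measurable_EFinP/measurable_funTS/measurable_funM => //; apply: measurableT_comp.
  - move=> y /=; rewrite in_itv/= andbT => y0; rewrite lee_fin -expRD ler_expR.
    have H1 := powR_ge_tangent a1 y0; have H2 := powR_ge0 y a.
    by have [y1|y1] := leP y 1; nra.
under eq_integral do rewrite EFinM.
rewrite ge0_integralZl_EFin//= ?expR_ge0// ?integral_expRN ?mule1 ?ltry//.
by apply/measurable_EFinP/measurable_funTS; apply: measurableT_comp.
Qed.

Lemma GammaV_gt0 (a : R) : 1 <= a -> 0 < Gamma a^-1.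
Proof.
move=> a1; have a0 : 0 < a by lra.
suff : (0 < (a^-1 * Gamma a^-1)%:E)%E by rewrite lte_fin pmulr_rgt0 ?invr_gt0.
rewrite -integral_expR_powR//.
have me := measurable_expR_powR a.
have : (\int[mu]_(y in `[0%R, 1%R]) (expR (- 1))%:E <=
    \int[mu]_(y in `[0%R, +oo[) (expR (- (y `^ a)))%:E)%E.
  apply: (@le_trans _ _ (\int[mu]_(y in `[0%R, 1%R]) (expR (- (y `^ a)))%:E)%E).
    apply: ge0_le_integral => //.
    - exact/measurable_EFinP/measurable_funTS.
    - move=> y /=; rewrite in_itv/= => /andP[y0 y1]; rewrite lee_fin ler_expR lerN2.
      have -> : (1 : R) = 1 `^ a by rewrite powR1.
      by apply: ge0_ler_powR; rewrite ?nnegrE// ltW.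
  apply: ge0_subset_integral => //.
  - exact/measurable_EFinP/measurable_funTS.
  - by move=> x /=; rewrite !in_itv/= => /andP[-> _].
apply: lt_le_trans; rewrite integral_cst//= lebesgue_measure_itv/= lte_fin ltr01.
by rewrite -EFinB subr0 mule1 lte_fin expR_gt0.
Qed.

End power_substitution.

(** * Integration against a measure given by a density *)

Section density.
Context d (T : measurableType d) (R : realType).
Variables (mu nu : {measure set T -> \bar R}) (f : T -> R).
Hypotheses (mf : measurable_fun [set: T] f) (f0 : forall x, 0 <= f x).
Hypothesis nuE : forall A, measurable A -> nu A = (\int[mu]_(x in A) (f x)%:E)%E.
Local Open Scope ereal_scope.

Import HBNNSimple.

Let ge0_integral_density_nnsfun (h : {nnsfun T >-> R}) :
  \int[nu]_x (h x)%:E = \int[mu]_x ((h x)%:E * (f x)%:E).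
Proof.
rewrite integralT_nnsfun sintegralE.
under [RHS]eq_integral => x _.
  rewrite fimfunE -fsumEFin// ge0_mule_fsuml; last first.
    by move=> r; rewrite EFinM nnfun_muleindic_ge0.
  over.
rewrite ge0_integral_fsum//; last 2 first.
- move=> r; apply: emeasurable_funM; last exact/measurable_EFinP.
  by apply/measurable_EFinP; apply: measurable_funM.
- by move=> r x _; rewrite mule_ge0 ?lee_fin// -lee_fin EFinM nnfun_muleindic_ge0.
apply: eq_fsbigr => r /[!inE] -[x _ <-]; rewrite nuE//.
rewrite [in LHS]integral_mkcond/= -ge0_integralZl_EFin//; last 2 first.
- by move=> y _; apply: erestrict_ge0 => z _; rewrite lee_fin.
- have mh : measurable (h @^-1` [set h x]) by [].
  apply: (iffLR (measurable_restrictT (EFin \o f) mh)).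
  exact/measurable_funTS/measurable_EFinP.
apply: eq_integral => y _; rewrite patchE indicE.
by case: ifPn => _; rewrite ?mulr1 ?mulr0 ?mul0e ?mule0.
Qed.

(** Holds for simple functions by linearity; monotone convergence on both sides extends it. *)
Lemma ge0_integral_density (g : T -> \bar R) :
  measurable_fun [set: T] g -> (forall x, 0 <= g x) ->
  \int[nu]_x g x = \int[mu]_x (g x * (f x)%:E).
Proof.
move=> mg g0; pose g_ := nnsfun_approx measurableT mg.
have cvg_g x : (g_ n x)%:E @[n --> \oo] --> g x.
  by apply: cvg_nnsfun_approx => // y _; exact: g0.
transitivity (limn (fun n => \int[nu]_x (g_ n x)%:E)).
  rewrite -monotone_convergence//.
  - by apply: eq_integral => x _; apply/esym/cvg_lim.
  - by move=> n; exact/measurable_EFinP/measurable_funTS.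
  - by move=> n x _; rewrite lee_fin.
  - by move=> x _ m n mn; rewrite lee_fin; exact/lefP/nd_nnsfun_approx.
transitivity (limn (fun n => \int[mu]_x ((g_ n x)%:E * (f x)%:E))).
  by congr (limn _); apply/funext => n; exact: ge0_integral_density_nnsfun.
rewrite -monotone_convergence//.
- apply: eq_integral => x _; apply/cvg_lim => //.
  by apply: cvgeZr.
- move=> n; apply/emeasurable_funM; apply/measurable_EFinP => //.
- by move=> n x _; rewrite mule_ge0// lee_fin.
- move=> x _ m n mn; rewrite lee_wpmul2r ?lee_fin//.
  exact/lefP/nd_nnsfun_approx.
Qed.

End density.

(** * Comparison of log-concave functions with exponentials *)

Section exponential_domination.
Context {R : realType}.
Local Notation mu := (@lebesgue_measure R).

(** [k] vanishes almost everywhere, so even an unbounded weight is harmless. *)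
Lemma ge0_integralM_eq0 (D : set R) (phi k : R -> R) : measurable D ->
  measurable_fun [set: R] phi -> measurable_fun [set: R] k ->
  (forall u, D u -> 0 <= phi u) -> (forall u, D u -> 0 <= k u) ->
  (\int[mu]_(u in D) (k u)%:E = 0)%E ->
  (\int[mu]_(u in D) (phi u * k u)%:E = 0)%E.
Proof.
move=> mD mphi mk phi0 k0 Ik.
have : (\int[mu]_(u in D) `|(k u)%:E| = 0)%E.
  rewrite -[RHS]Ik; apply: eq_integral => u /[!inE] Du.
  by rewrite gee0_abs// lee_fin k0.
move/ae_eq_integral_abs => /(_ mD) kae0.
have {kae0} : ae_eq mu D (EFin \o k) (cst 0%E).
  by apply: kae0; exact/measurable_EFinP/measurable_funTS.
move=> kae0; rewrite (@ge0_ae_eq_integral _ _ _ mu D _ (cst 0%E))//.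
- by rewrite integral0.
- exact/measurable_EFinP/measurable_funTS/measurable_funM.
- by move=> u Du; rewrite lee_fin mulr_ge0 ?phi0 ?k0.
- apply: filterS kae0 => u + Du => /(_ Du)/= [->].
  by rewrite mulr0.
Qed.

Lemma ge0_integral_expR_scale (a : R) (phi : R -> R) : 0 < a ->
  measurable_fun [set: R] phi -> (forall u, 0 <= u -> 0 <= phi u) ->
  (\int[mu]_(u in `[0%R, +oo[) (phi u * expR (- (u / a)))%:E =
   a%:E * \int[mu]_(u in `[0%R, +oo[) (phi (a * u)%R * expR (- u))%:E)%E.
Proof.
move=> a0 mphi phi0.
rewrite (@ge0_integral_scale _ a (fun u => (phi u * expR (- (u / a)))%:E))//.
- by congr (_ * _)%E; apply: eq_integral => u _; rewrite mulrAC divff ?gt_eqF// mul1r.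
- apply/measurable_EFinP/measurable_funM => //.
  by do 2 apply: measurableT_comp => //; apply: measurable_funM.
- by move=> x x0; rewrite lee_fin mulr_ge0 ?phi0 ?expR_ge0.
Qed.

(** The right side is the integral of [phi] against the comparison exponential, of rate M / q, after
    u is rescaled by q / M. In [hlc] log-concavity is used along chords from 0, where [h] has the
    value [M]. *)
Lemma logconcave_dominated (h phi : R -> R) (M q : R) : 0 < M ->
  measurable_fun [set: R] h -> (forall u, 0 <= h u) -> h 0 = M ->
  (forall u t, 0 <= u -> 0 <= t <= 1 -> h u `^ t * M `^ (1 - t) <= h (t * u)) ->
  (\int[mu]_(u in `[0%R, +oo[) (h u)%:E = q%:E)%E ->
  measurable_fun [set: R] phi -> (forall u, 0 <= u -> 0 <= phi u) ->
  (forall u v, 0 <= u -> u <= v -> phi u <= phi v) ->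
  (\int[mu]_(u in `[0%R, +oo[) (phi u * h u)%:E <=
   q%:E * \int[mu]_(u in `[0%R, +oo[) (phi (q / M * u)%R * expR (- u))%:E)%E.
Proof.
move=> M0 mh h0 hM hlc Ih mphi phi0 phim.
have Dge (u : R) : `[0%R, +oo[%classic u -> 0 <= u by rewrite /= in_itv/= andbT.
have q0 : 0 <= q.
  by rewrite -lee_fin -Ih; apply: integral_ge0 => u _; rewrite lee_fin.
(* Mass zero occurs, for instance when the base point ends the support; then there is no exponential
   to compare with, and [h] is null. *)
move: q0; rewrite le_eqVlt => /predU1P[q0|q0].
  rewrite ge0_integralM_eq0//; last 2 first.
  - by move=> u /Dge; exact: phi0.
  - by rewrite Ih -q0.
  rewrite mule_ge0// ?lee_fin -?q0//; apply: integral_ge0 => u /Dge u0.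
  by rewrite lee_fin mulr_ge0 ?expR_ge0// phi0// mul0r mul0r.
set a := q / M; have a0 : 0 < a by rewrite divr_gt0.
pose g u := M * expR (- (u / a)).
have g0 u : 0 <= g u by rewrite mulr_ge0 ?expR_ge0// ltW.
have mg : measurable_fun [set: R] g.
  apply: measurable_funM => //.
  by do 2 apply: measurableT_comp => //; apply: measurable_funM.
have qMa : q = M * a by rewrite /a mulrC divfK// gt_eqF.
have -> : (q%:E * \int[mu]_(u in `[0%R, +oo[) (phi (a * u)%R * expR (- u))%:E =
    \int[mu]_(u in `[0%R, +oo[) (phi u * g u)%:E)%E.
  under [RHS]eq_integral do rewrite mulrCA EFinM.
  rewrite ge0_integralZl_EFin//; last 3 first.
  - by move=> u /Dge u0; rewrite lee_fin mulr_ge0 ?expR_ge0// phi0.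
  - apply/measurable_EFinP/measurable_funTS/measurable_funM => //.
    by do 2 apply: measurableT_comp => //; apply: measurable_funM.
  - exact: ltW.
  by rewrite (ge0_integral_expR_scale a0 mphi phi0) qMa EFinM muleA.
have Ig : (\int[mu]_(u in `[0%R, +oo[) (g u)%:E = q%:E)%E.
  under eq_integral do rewrite EFinM.
  rewrite ge0_integralZl_EFin//; last 2 first.
  - apply/measurable_EFinP/measurable_funTS.
    by do 2 apply: measurableT_comp => //; apply: measurable_funM.
  - exact: ltW.
  have -> : (\int[mu]_(u in `[0%R, +oo[) (expR (- (u / a)))%:E = a%:E)%E.
    transitivity (\int[mu]_(u in `[0%R, +oo[) (cst 1 u * expR (- (u / a)))%:E)%E.
      by apply: eq_integral => u _; rewrite /= mul1r.
    rewrite ge0_integral_expR_scale// -[RHS]mule1 -integral_expRN; congr (_ * _)%E.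
    by apply: eq_integral => u _; rewrite /= mul1r.
  by rewrite qMa EFinM.
(* On [[0, u]] ln g is affine and ln h is above its chord, with the same value at 0. So [g <= h] at
   [u] propagates down to 0, and the set where it holds is an initial segment. *)
have Adown u x : g u <= h u -> 0 <= x -> x <= u -> g x <= h x.
  move=> ghu x0 xu.
  have [u0|u0] := eqVneq u 0.
    by move: xu ghu; rewrite u0 => xu; have -> : x = 0 by lra.
  have u0' : 0 < u by rewrite lt_neqAle eq_sym u0 (le_trans x0).
  have t01 : 0 <= x / u <= 1 by rewrite divr_ge0 ?(ltW u0')//= ler_pdivrMr// mul1r.
  have := hlc u (x / u) (ltW u0') t01; rewrite divfK//; apply: le_trans.
  have : g u `^ (x / u) * M `^ (1 - x / u) <= h u `^ (x / u) * M `^ (1 - x / u).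
    rewrite ler_wpM2r ?powR_ge0// ge0_ler_powR ?nnegrE//.
    by case/andP: t01.
  apply: le_trans; rewrite /g powRM ?expR_ge0 ?(ltW M0)// mulrAC -powRD; last first.
    by rewrite (gt_eqF M0) implybT.
  rewrite subrKC powRr1 ?(ltW M0)// -expRM.
  rewrite (_ : - (u / a) * (x / u) = - (x / a))//.
  by field; rewrite u0 gt_eqF.
have [[y [y0 hgy]]|NA] := pselect (exists y, 0 <= y /\ h y < g y).
  pose A := [set u | 0 <= u /\ g u <= h u].
  have Ay u : A u -> u <= y.
    move=> [u0 gu]; rewrite leNgt; apply/negP => /ltW yu.
    by have := Adown u y gu y0 yu; rewrite leNgt hgy.
  have A0 : A 0 by split=> //; rewrite hM /g mul0r oppr0 expR0 mulr1.
  (* k separates the values of phi before and after the crossing point of h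
     and g, so (phi u - k) * (h u - g u) <= 0 for all u >= 0. *)
  pose k := sup (phi @` A).
  have supA : has_sup (phi @` A).
    split; first by exists (phi 0), 0.
    by exists (phi y) => _ [u Au <-]; apply: phim; [case: Au|exact: Ay].
  have kA u : A u -> phi u <= k by move=> Au; apply: (ub_le_sup supA.2); exists u.
  have k0 : 0 <= k by apply: le_trans (kA _ A0); exact: phi0.
  have kN u : 0 <= u -> ~ A u -> k <= phi u.
    move=> u0 NAu; apply: ge_sup; first exact: supA.1.
    move=> _ [v Av <-]; apply: phim; first by case: Av.
    rewrite leNgt; apply/negP => /ltW uv; apply: NAu; split => //.
    by apply: (Adown v) => //; case: Av.
  have Ik (j : R -> R) : measurable_fun [set: R] j -> (forall u, 0 <= j u) ->
    (\int[mu]_(u in `[0%R, +oo[) (j u)%:E = q%:E)%E ->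
    (\int[mu]_(u in `[0%R, +oo[) (k * j u)%:E = (k * q)%:E)%E.
    move=> mj j0 Ij; under eq_integral do rewrite EFinM.
    rewrite ge0_integralZl_EFin//; last 2 first.
    + by move=> u _; rewrite lee_fin.
    + exact/measurable_EFinP/measurable_funTS.
    by rewrite Ij EFinM.
  (* [k * q] is the integral of both [k * g] and [k * h]. Adding it turns (phi - k)(h - g) <= 0 into
     an inequality between nonnegative integrands, whose integrals may be infinite. *)
  rewrite -(@leeD2rE _ (k * q)%:E)// -{1}(Ik _ mg g0 Ig) -(Ik _ mh h0 Ih).
  have mM (j : R -> R) : measurable_fun [set: R] j ->
      measurable_fun (`[0, +oo[%classic : set R) (fun u => (phi u * j u)%:E).
    by move=> mj; apply/measurable_EFinP/measurable_funTS/measurable_funM.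
  have mK (j : R -> R) : measurable_fun [set: R] j ->
      measurable_fun (`[0, +oo[%classic : set R) (fun u => (k * j u)%:E).
    by move=> mj; apply/measurable_EFinP/measurable_funTS/measurable_funM.
  have Mp (j : R -> R) : (forall u, 0 <= j u) -> forall u,
      (`[0, +oo[%classic : set R) u -> (0 <= (phi u * j u)%:E)%E.
    by move=> j0 u /Dge u0; rewrite lee_fin mulr_ge0// phi0.
  have Kp (j : R -> R) : (forall u, 0 <= j u) -> forall u,
      (`[0, +oo[%classic : set R) u -> (0 <= (k * j u)%:E)%E.
    by move=> j0 u /Dge u0; rewrite lee_fin mulr_ge0.
  rewrite -!ge0_integralD//; try (by [exact: Mp|exact: Kp|exact: mM|exact: mK]).
  apply: ge0_le_integral => //.
  - by move=> u Du; rewrite adde_ge0 ?Mp ?Kp.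
  - by apply: emeasurable_funD; [exact: mM|exact: mK].
  - by apply: emeasurable_funD; [exact: mM|exact: mK].
  - move=> u /Dge u0; rewrite -!EFinD lee_fin.
    have [guh|hgu] := leP (g u) (h u).
      have := kA u (conj u0 guh); nra.
    have : ~ A u by move=> [_]; rewrite leNgt hgu.
    move=> /(kN u u0); nra.
(* Without a crossing [h] stays above [g] with the same mass, so they agree almost everywhere. *)
have gh u : 0 <= u -> g u <= h u.
  by move=> u0; rewrite leNgt; apply/negP => hg; apply: NA; exists u.
have mhg : measurable_fun [set: R] (fun u => h u - g u) by exact: measurable_funB.
have hg0 u : 0 <= u -> 0 <= h u - g u by move=> u0; rewrite subr_ge0 gh.
have Ihg : (\int[mu]_(u in `[0%R, +oo[) (h u - g u)%:E = 0)%E.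
  have : (\int[mu]_(u in `[0%R, +oo[) (h u - g u)%:E + q%:E = 0 + q%:E)%E.
    rewrite -{1}Ig -ge0_integralD//; last 4 first.
    - by move=> u /Dge /hg0; rewrite lee_fin.
    - exact/measurable_EFinP/measurable_funTS.
    - by move=> u _; rewrite lee_fin.
    - exact/measurable_EFinP/measurable_funTS.
    by rewrite add0e -Ih; apply: eq_integral => u _; rewrite -EFinD subrK.
  by move/(congr1 (fun z => z - q%:E)%E); rewrite !addeK.
have Ip : (\int[mu]_(u in `[0%R, +oo[) (phi u * (h u - g u))%:E = 0)%E.
  apply: ge0_integralM_eq0 => // u /Dge; [exact: phi0|exact: hg0].
have -> : (\int[mu]_(u in `[0%R, +oo[) (phi u * h u)%:E =
   \int[mu]_(u in `[0%R, +oo[) ((phi u * (h u - g u))%:E + (phi u * g u)%:E))%E.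
  by apply: eq_integral => u _; rewrite -EFinD; congr EFin; ring.
rewrite ge0_integralD//; last 4 first.
- by move=> u /Dge u0; rewrite lee_fin mulr_ge0 ?phi0 ?hg0.
- exact/measurable_EFinP/measurable_funTS/measurable_funM.
- by move=> u /Dge u0; rewrite lee_fin mulr_ge0 ?phi0.
- exact/measurable_EFinP/measurable_funTS/measurable_funM.
by rewrite Ip add0e.
Qed.

End exponential_domination.

(** * The numerical inequality and the integrals behind it *)

Section moment_bound.
Context {R : realType}.
Local Notation mu := (@lebesgue_measure R).

Lemma powR_le1 (x c : R) : 0 <= x <= 1 -> 0 <= c -> x `^ c <= 1.
Proof.
move=> /andP[x0 x1] c0; have -> : (1 : R) = 1 `^ c by rewrite powR1.
by apply: ge0_ler_powR; rewrite ?nnegrE.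
Qed.

(** Here [q] is the mass on the side of the mean, [p] the other mass, [n] the height at the base
    point times the distance to the mean. The summands stand for the part beyond the mean, the part
    before it and the opposite side. All bases of powers lie in [0, 1], so the powers can be reduced
    until q^2 + p^2 + p q <= (q + p)^2 = 1 decides. *)
Lemma moment_bound_scaled (alpha G q p n : R) : 1 <= alpha -> 1 <= G ->
  0 <= q -> 0 <= p -> q + p = 1 -> 0 <= n -> n <= q ^+ 2 ->
  q * q `^ alpha * expR (- (n / q)) * G + 11 / 20 * (n `^ (alpha - 1) * n ^+ 2) +
  p * ((p + n) `^ (alpha - 1) * (p * G + n)) <= G.
Proof.
move=> a1 G1 q0 p0 qp n0 nq.
have a10 : 0 <= alpha - 1 by rewrite subr_ge0.
have q1 : q <= 1 by lra.
have n1 : n <= 1 by nra.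
have e1 : q * q `^ alpha <= q ^+ 2.
  rewrite expr2 ler_wpM2l//; have [q00|q00] := eqVneq q 0.
    by rewrite q00 powR0//; lra.
  by apply: ge1r_powR => //; rewrite q1 andbT lt_neqAle eq_sym q00.
have e2 : n `^ (alpha - 1) * n ^+ 2 <= n ^+ 2.
  by rewrite ler_piMl ?sqr_ge0//; apply: powR_le1; rewrite ?n0.
have e3 : (p + n) `^ (alpha - 1) * (p * G + n) <= (p + n) * G.
  have : (p + n) `^ (alpha - 1) * (p * G + n) <= p * G + n.
    rewrite ler_piMl//; first by nra.
    by apply: powR_le1 => //; nra.
  nra.
have [q00|q00] := eqVneq q 0.
  have n00 : n = 0 by apply/eqP; rewrite eq_le n0 andbT (le_trans nq)// q00 expr0n.
  have p1 : p = 1 by lra.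
  move: e2 e3; rewrite q00 n00 p1 expr0n/= !mul0r !mulr0; lra.
have q_gt0 : 0 < q by rewrite lt_neqAle eq_sym q00.
set s := n / q; have ns : n = q * s by rewrite /s mulrC divfK.
have s0 : 0 <= s by rewrite divr_ge0.
have sq : s <= q by rewrite /s ler_pdivrMr// -expr2.
set E := expR (- s); have E0 : 0 < E by exact: expR_gt0.
(* Squaring [1 + s / 2 <= expR (s / 2)] leaves 1 - 4/9 = 5/9 at s = 1, just above 11/20;
   [1 + s <= expR s] would leave only 1/2. *)
have E1 : E * (1 + s / 2) ^+ 2 <= 1.
  have Eh : expR (s / 2) ^+ 2 = E^-1.
    by rewrite /E expRN invrK expr2 -expRD; congr expR; field.
  have : (1 + s / 2) ^+ 2 <= expR (s / 2) ^+ 2.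
    by rewrite ler_sqr ?nnegrE ?expR_ge0 ?expR_ge1Dx// addr_ge0// divr_ge0.
  by rewrite Eh -(ler_pM2l E0) divff ?gt_eqF.
have E2 : E + 11 / 20 * s ^+ 2 <= 1.
  have H : 1 <= (1 - 11 / 20 * s ^+ 2) * (1 + s / 2) ^+ 2.
    have s1 : s <= 1 by lra.
    have h2 : s ^+ 2 <= s by rewrite expr2 ler_piMl.
    have h3 : s ^+ 3 <= s by rewrite exprS; nra.
    have h4 : s ^+ 4 <= s by rewrite exprS; nra.
    have -> : (1 - 11 / 20 * s ^+ 2) * (1 + s / 2) ^+ 2 =
      1 + s - 3 / 10 * s ^+ 2 - 11 / 20 * s ^+ 3 - 11 / 80 * s ^+ 4 by field.
    lra.
  have P0 : 0 < (1 + s / 2) ^+ 2 by rewrite exprn_gt0// ltr_wpDr// divr_ge0.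
  rewrite -(ler_pM2r P0) mulrDl mul1r; nra.
have : q * q `^ alpha * E * G <= q ^+ 2 * E * G.
  by rewrite !ler_wpM2r// ?(ltW E0)//; lra.
have H2 : q ^+ 2 * (E + 11 / 20 * s ^+ 2) <= q ^+ 2 by rewrite ler_piMr// sqr_ge0.
have H3 : q ^+ 2 * E + 11 / 20 * n ^+ 2 + p * (p + n) <= 1.
  have qp2 : q ^+ 2 + 2 * p * q + p ^+ 2 = 1.
    transitivity ((q + p) ^+ 2); first by ring.
    by rewrite qp expr1n.
  have : p * (q * s) <= p * (q * 1) by rewrite !ler_wpM2l//; lra.
  have : 0 <= p * q by rewrite mulr_ge0.
  rewrite ns exprMn; lra.
have H4 : G * (q ^+ 2 * E + 11 / 20 * n ^+ 2 + p * (p + n)) <= G by rewrite ler_piMr//; lra.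
have H5 : p * ((p + n) `^ (alpha - 1) * (p * G + n)) <= p * ((p + n) * G).
  by rewrite ler_wpM2l.
have H6 : 11 / 20 * n ^+ 2 <= G * (11 / 20 * n ^+ 2).
  by rewrite ler_peMl// mulr_ge0// sqr_ge0.
lra.
Qed.

(** Memorylessness: beyond [c] the exponential is [expR (- c)] times a fresh copy of itself. *)
Lemma integral_shifted_powR_expRN (alpha c : R) : 0 < alpha -> 0 <= c ->
  (\int[mu]_(u in `[0%R, +oo[) (Num.max (u - c) 0 `^ alpha * expR (- u))%:E =
   (expR (- c) * Gamma (alpha + 1))%:E)%E.
Proof.
move=> a0 c0; pose F (u : R) := (Num.max (u - c) 0 `^ alpha * expR (- u))%:E.
have mF : measurable_fun [set: R] F.
  apply/measurable_EFinP/measurable_funM; last exact: measurableT_comp.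
  apply: (@measurableT_comp _ _ _ _ _ _ (@powR R ^~ alpha)); first exact: measurable_powR.
  by apply: measurable_maxr => //; exact: measurable_funB.
have F0 u : (0 <= F u)%E by rewrite lee_fin mulr_ge0 ?powR_ge0 ?expR_ge0.
transitivity (\int[mu]_(u in `[c, +oo[) F u)%E.
  rewrite [LHS]integral_mkcond [RHS]integral_mkcond; apply: eq_integral => u _.
  rewrite !patchE !mem_setE !in_itv/= !andbT; case: (leP c u) => cu.
    by rewrite (le_trans c0).
  case: ifPn => // _.
  by rewrite (max_idPr _) ?powR0 ?gt_eqF ?mul0r// subr_le0 ltW.
rewrite ge0_integral_shift//.
rewrite EFinM -integral_powR_expRN// -ge0_integralZl_EFin ?expR_ge0//; last 2 first.
- by move=> u _; rewrite lee_fin mulr_ge0 ?powR_ge0 ?expR_ge0.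
- by apply/measurable_EFinP/measurable_funTS; exact: measurable_powR_expRN.
apply: eq_integral => u; rewrite inE/= in_itv/= andbT => u0.
rewrite /F addrK (max_idPl u0) opprD expRD -EFinM; congr EFin; ring.
Qed.

Lemma integral_max_subr (m : R) : 0 <= m ->
  (\int[mu]_(u in `[0%R, +oo[) (Num.max (m - u) 0)%:E = (m ^+ 2 / 2)%:E)%E.
Proof.
rewrite le_eqVlt => /predU1P[<-|m0].
  rewrite expr0n mul0r integral0_eq// => u /=; rewrite in_itv/= andbT => u0.
  by rewrite (max_idPr _)// sub0r oppr_le0.
transitivity (\int[mu]_(u in `[0%R, m]) (m - u)%:E)%E.
  rewrite [LHS]integral_mkcond [RHS]integral_mkcond; apply: eq_integral => u _.
  rewrite !patchE !mem_setE !in_itv/= !andbT; case: (leP 0 u) => //= u0.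
  case: (leP u m) => um; first by rewrite (max_idPl _)// subr_ge0.
  by rewrite (max_idPr _)// subr_le0 ltW.
have cF : continuous (fun u : R => m * u - u ^+ 2 / 2).
  move=> u; apply: cvgB; first by apply: cvgMr; exact: cvg_id.
  by apply: cvgMl; exact: exprn_continuous.
have cf : {within `[0, m], continuous (fun u : R => m - u)}.
  by apply: continuous_subspaceT => u; apply: cvgB; [exact: cvg_cst|exact: cvg_id].
rewrite (@continuous_FTC2 _ _ (fun u => m * u - u ^+ 2 / 2) 0 m)//.
- rewrite -EFinB; congr EFin; by field.
- split.
  + by move=> u _; apply: ex_derive.
  + exact/cvg_at_right_filter/cF.
  + exact/cvg_at_left_filter/cF.
- move=> u _; rewrite derive1E derive_val /GRing.scale/=. by field.
Qed.

(** Convexity of the power: b u + m is b + m times the mean of u and 1 with weights b / (b + m) and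
    m / (b + m). *)
Lemma powRDM_le (alpha b m u : R) : 1 <= alpha -> 0 <= b -> 0 <= m -> 0 <= u ->
  (b * u + m) `^ alpha <= (b + m) `^ (alpha - 1) * (b * u `^ alpha + m).
Proof.
move=> a1 b0 m0 u0; have a0 : 0 < alpha by lra.
have [bm|bm] := eqVneq (b + m) 0.
  have -> : b = 0 by lra.
  have -> : m = 0 by lra.
  by rewrite !mul0r !addr0 mulr0 powR0 ?gt_eqF.
have bm0 : 0 < b + m by rewrite lt_neqAle eq_sym bm addr_ge0.
have w0 : 0 <= b / (b + m) by rewrite divr_ge0// ltW.
have w1 : b / (b + m) <= 1 by rewrite ler_pdivrMr// mul1r lerDl.
have := @convex_powR R alpha a1 (Itv01 w0 w1) u 1.
rewrite !inE/= !in_itv/= !andbT => /(_ u0 ler01).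
move=> H; rewrite [leRHS]convRE [X in X `^ _ <= _]convRE/= /unstable.onem powR1 !mulr1 in H.
have -> : b * u + m = (b + m) * (b / (b + m) * u + (1 - b / (b + m))).
  by field.
have z0 : 0 <= b / (b + m) * u + (1 - b / (b + m)).
  by apply: addr_ge0; [exact: mulr_ge0|rewrite subr_ge0].
rewrite powRM ?(ltW bm0)//.
rewrite -mulr_powRB1 ?(ltW bm0)// -mulrA mulrCA ler_wpM2l ?powR_ge0//.
have -> : b * u `^ alpha + m = (b + m) * (b / (b + m) * u `^ alpha + (1 - b / (b + m))).
  by field.
by rewrite ler_wpM2l// ltW.
Qed.

End moment_bound.

(** * The moment about the mean, assembled from both sides of the base point *)

Section two_sided_moment_bound.
Context {R : realType}.
Local Notation mu := (@lebesgue_measure R).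

Let Dge (u : R) : `[0%R, +oo[%classic u -> 0 <= u.
Proof. by rewrite /= in_itv/= andbT. Qed.

Section tails.
Variables (alpha M m : R) (h : R -> R).
Hypotheses (alpha1 : 1 <= alpha) (M0 : 0 < M) (m0 : 0 <= m).
Hypotheses (mh : measurable_fun [set: R] h) (h0 : forall u, 0 <= h u).
Hypothesis hM : h 0 = M.
Hypothesis hlc : forall u t, 0 <= u -> 0 <= t <= 1 ->
  h u `^ t * M `^ (1 - t) <= h (t * u).
Variable q : R.
Hypothesis Ih : (\int[mu]_(u in `[0%R, +oo[) (h u)%:E = q%:E)%E.

Let alpha0 : 0 < alpha. Proof. by apply: lt_le_trans alpha1. Qed.

Lemma tail_mass_ge0 : 0 <= q.
Proof.
by rewrite -lee_fin -Ih; apply: integral_ge0 => u _; rewrite lee_fin.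
Qed.

(** The weight u in [logconcave_dominated]: the exponential of height [M] and mass [q] has first
    moment q^2 / M. This limits how far the mean can lie from the base point. *)
Lemma tail_mean_le : (m%:E <= \int[mu]_(u in `[0%R, +oo[) (u * h u)%:E)%E ->
  m <= q ^+ 2 / M.
Proof.
move=> mI; rewrite -lee_fin (le_trans mI)//.
have := @logconcave_dominated R h id M q M0 mh h0 hM hlc Ih.
move=> /(_ _ _ _) /le_trans; apply => //.
have qM0 : 0 <= q / M by rewrite divr_ge0 ?tail_mass_ge0// ltW.
under eq_integral do rewrite /= -mulrA EFinM.
rewrite ge0_integralZl_EFin//; last 2 first.
- by move=> u /Dge u0; rewrite lee_fin mulr_ge0 ?expR_ge0.
- apply/measurable_EFinP/measurable_funTS/measurable_funM => //.
  exact: measurableT_comp.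
by rewrite integral_id_expRN mule1 -EFinM expr2 mulrA.
Qed.

(** The weight |u - m|^alpha is not monotone, so it is split at [m]; its part beyond [m] is
    increasing and can be dominated. The exponential factor is memorylessness, with [m] measured in
    units of q / M. *)
Lemma tail_upper_le : m = 0 \/ 0 < q ->
  (\int[mu]_(u in `[0%R, +oo[) (Num.max (u - m) 0 `^ alpha * h u)%:E <=
   (q * (q / M) `^ alpha * expR (- (M * m / q)) * Gamma (alpha + 1))%:E)%E.
Proof.
move=> mq.
have mphi : measurable_fun [set: R] (fun u => Num.max (u - m) 0 `^ alpha).
  apply: (@measurableT_comp _ _ _ _ _ _ (@powR R ^~ alpha)); first exact: measurable_powR.
  by apply: measurable_maxr => //; exact: measurable_funB.
have := @logconcave_dominated R h (fun u => Num.max (u - m) 0 `^ alpha) M q M0 mh h0 hM hlc Ih mphi.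
move=> /(_ _ _) /le_trans; apply => //.
- by move=> u _; exact: powR_ge0.
- move=> u v u0 uv; apply: ge0_ler_powR; rewrite ?(ltW alpha0) ?nnegrE//.
  + by rewrite le_max lexx orbT.
  + by rewrite le_max lexx orbT.
  + by rewrite ge_max !le_max lexx lerD2r uv !orbT.
have := tail_mass_ge0; rewrite le_eqVlt => /predU1P[<-|q0].
  by rewrite !mul0r mul0e.
have qM0 : 0 < q / M by rewrite divr_gt0.
rewrite -!(mulrA q) [in leRHS]EFinM lee_pmul2l//.
rewrite -mulrA EFinM -(@integral_shifted_powR_expRN R alpha (M * m / q))//; last first.
  by rewrite divr_ge0// ?mulr_ge0// ltW.
rewrite -ge0_integralZl_EFin ?powR_ge0//; last 2 first.
- by move=> u _; rewrite lee_fin mulr_ge0 ?powR_ge0 ?expR_ge0.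
- apply/measurable_EFinP/measurable_funTS/measurable_funM; last exact: measurableT_comp.
  apply: (@measurableT_comp _ _ _ _ _ _ (@powR R ^~ alpha)); first exact: measurable_powR.
  by apply: measurable_maxr => //; exact: measurable_funB.
rewrite le_eqVlt; apply/orP; left; apply/eqP; apply: eq_integral => u _.
rewrite -EFinM mulrA; congr (_ * _)%:E.
rewrite -powRM ?(ltW qM0) ?le_max ?lexx ?orbT//; congr (_ `^ _).
rewrite maxr_pMr ?(ltW qM0)// mulr0; congr Num.max.
by field; rewrite !gt_eqF.
Qed.

(** Before [m] the weight decreases, so [h] is bounded crudely, and (m - u)^alpha <= m^(alpha - 1)
    (m - u). The integral m^2 / 2 of m - u halves 11/10. *)
Lemma tail_lower_le : (forall u, 0 <= u -> h u <= 11 / 10 * M) ->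
  (\int[mu]_(u in `[0%R, +oo[) (Num.max (m - u) 0 `^ alpha * h u)%:E <=
   (11 / 20 * M * m `^ (alpha - 1) * m ^+ 2)%:E)%E.
Proof.
move=> hle.
have mmax : measurable_fun [set: R] (fun u => Num.max (m - u) 0).
  by apply: measurable_maxr => //; exact: measurable_funB.
apply: (@le_trans _ _ (\int[mu]_(u in `[0%R, +oo[)
   ((11 / 10 * M * m `^ (alpha - 1))%:E * (Num.max (m - u) 0)%:E))%E).
  apply: ge0_le_integral => //.
  - by move=> u _; rewrite lee_fin mulr_ge0// powR_ge0.
  - apply/measurable_EFinP/measurable_funTS/measurable_funM => //.
    by apply: (@measurableT_comp _ _ _ _ _ _ (@powR R ^~ alpha)) => //; exact: measurable_powR.
  - apply/measurable_funTS/emeasurable_funM => //; exact/measurable_EFinP.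
  - move=> u /Dge u0; rewrite -EFinM lee_fin.
    set x := Num.max (m - u) 0.
    have x0 : 0 <= x by rewrite le_max lexx orbT.
    have xm : x <= m by rewrite ge_max m0 andbT lerBlDr lerDl.
    rewrite -(mulr_powRB1 x0 alpha0).
    have H1 : x `^ (alpha - 1) <= m `^ (alpha - 1).
      by apply: ge0_ler_powR; rewrite ?nnegrE ?subr_ge0.
    have H2 := hle u u0.
    have : x `^ (alpha - 1) * h u <= m `^ (alpha - 1) * (11 / 10 * M).
      by apply: ler_pM; rewrite ?powR_ge0.
    by move=> /(ler_wpM2l x0); lra.
rewrite ge0_integralZl_EFin//; last 3 first.
- by move=> u _; rewrite lee_fin le_max lexx orbT.
- exact/measurable_EFinP/measurable_funTS.
- by rewrite mulr_ge0 ?powR_ge0 ?mulr_ge0 ?(ltW M0)//; lra.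
rewrite integral_max_subr// -EFinM lee_fin le_eqVlt; apply/orP; left; apply/eqP.
by field.
Qed.

(** Away from the mean the weight is increasing. Domination turns it into (b u + m)^alpha with b = q
    / M, which [powRDM_le] separates into Gamma integrals. *)
Lemma tail_opposite_le :
  (\int[mu]_(u in `[0%R, +oo[) ((u + m) `^ alpha * h u)%:E <=
   (q * ((q / M + m) `^ (alpha - 1) * (q / M * Gamma (alpha + 1) + m)))%:E)%E.
Proof.
have q0 := tail_mass_ge0.
have qM0 : 0 <= q / M by rewrite divr_ge0// ltW.
have mphi : measurable_fun [set: R] (fun u => (u + m) `^ alpha).
  apply: (@measurableT_comp _ _ _ _ _ _ (@powR R ^~ alpha)); first exact: measurable_powR.
  exact: measurable_funD.
have := @logconcave_dominated R h (fun u => (u + m) `^ alpha) M q M0 mh h0 hM hlc Ih mphi.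
move=> /(_ _ _) /le_trans; apply => //.
- by move=> u _; exact: powR_ge0.
- move=> u v u0 uv; apply: ge0_ler_powR; rewrite ?nnegrE ?addr_ge0 ?(ltW alpha0)//.
    exact: le_trans uv.
  by rewrite lerD2r.
rewrite [leRHS]EFinM lee_wpmul2l ?lee_fin//.
have me : measurable_fun [set: R] (fun u => expR (- u)) by exact: measurableT_comp.
set b := q / M; set K := (b + m) `^ (alpha - 1).
have K0 : 0 <= K by exact: powR_ge0.
have mpe := measurable_powR_expRN (R := R) alpha.
apply: (@le_trans _ _ (\int[mu]_(u in `[0%R, +oo[)
   ((K * b)%:E * (u `^ alpha * expR (- u))%:E + (K * m)%:E * (expR (- u))%:E))%E).
  apply: ge0_le_integral => //.
  - by move=> u _; rewrite lee_fin mulr_ge0 ?powR_ge0 ?expR_ge0.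
  - apply/measurable_EFinP/measurable_funTS/measurable_funM => //.
    apply: (@measurableT_comp _ _ _ _ _ _ (@powR R ^~ alpha)); first exact: measurable_powR.
    by apply: measurable_funD => //; exact: measurable_funM.
  - apply/measurable_funTS/emeasurable_funD; apply/emeasurable_funM => //;
      exact/measurable_EFinP.
  - move=> u /Dge u0; rewrite -!EFinM -EFinD lee_fin.
    rewrite mulrA -mulrDl ler_wpM2r ?expR_ge0//.
    have := @powRDM_le R alpha b m u alpha1 qM0 m0 u0; rewrite -/K; lra.
rewrite ge0_integralD//; last 4 first.
- by move=> u _; rewrite mule_ge0// lee_fin; [exact: mulr_ge0|rewrite mulr_ge0 ?powR_ge0 ?expR_ge0].
- by apply/measurable_funTS/emeasurable_funM => //; exact/measurable_EFinP.
- by move=> u _; rewrite mule_ge0// lee_fin mulr_ge0.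
- by apply/measurable_funTS/emeasurable_funM => //; exact/measurable_EFinP.
rewrite !ge0_integralZl_EFin ?(mulr_ge0 K0 qM0) ?(mulr_ge0 K0 m0)//; last 3 first.
- exact/measurable_EFinP/measurable_funTS.
- by move=> u _; rewrite lee_fin mulr_ge0 ?powR_ge0 ?expR_ge0.
- exact/measurable_EFinP/measurable_funTS.
rewrite integral_powR_expRN// integral_expRN mule1 -EFinM -EFinD lee_fin.
by rewrite le_eqVlt; apply/orP; left; apply/eqP; ring.
Qed.

End tails.

(** Multiplication by M^alpha and n = M m turn the sum of the three tail bounds into
    [moment_bound_scaled]. *)
Lemma two_sided_moment_bound (alpha M m q p : R) (hp hm : R -> R) :
  1 <= alpha -> 0 < M -> 0 <= m ->
  measurable_fun [set: R] hp -> measurable_fun [set: R] hm ->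
  (forall u, 0 <= hp u) -> (forall u, 0 <= hm u) ->
  hp 0 = M -> hm 0 = M ->
  (forall u t, 0 <= u -> 0 <= t <= 1 -> hp u `^ t * M `^ (1 - t) <= hp (t * u)) ->
  (forall u t, 0 <= u -> 0 <= t <= 1 -> hm u `^ t * M `^ (1 - t) <= hm (t * u)) ->
  (\int[mu]_(u in `[0%R, +oo[) (hp u)%:E = q%:E)%E ->
  (\int[mu]_(u in `[0%R, +oo[) (hm u)%:E = p%:E)%E ->
  q + p = 1 ->
  (forall u, 0 <= u -> hp u <= 11 / 10 * M) ->
  (m%:E <= \int[mu]_(u in `[0%R, +oo[) (u * hp u)%:E)%E ->
  (\int[mu]_(u in `[0%R, +oo[) (`|u - m| `^ alpha * hp u)%:E +
   \int[mu]_(u in `[0%R, +oo[) ((u + m) `^ alpha * hm u)%:E <=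
   (Gamma (alpha + 1) / M `^ alpha)%:E)%E.
Proof.
move=> a1 M0 m0 mhp mhm hp0 hm0 hpM hmM hplc hmlc Ihp Ihm qp hple mI.
have a0 : 0 < alpha by lra.
have q0 : 0 <= q := tail_mass_ge0 hp0 Ihp.
have p0 : 0 <= p := tail_mass_ge0 hm0 Ihm.
have mq : m <= q ^+ 2 / M := tail_mean_le M0 mhp hp0 hpM hplc Ihp mI.
have mq0 : m = 0 \/ 0 < q.
  move: q0; rewrite le_eqVlt => /predU1P[q0|]; last by right.
  by left; apply/eqP; rewrite eq_le m0 andbT (le_trans mq)// -q0 expr0n mul0r.
have T1 := tail_upper_le a1 M0 m0 mhp hp0 hpM hplc Ihp.
have T2 := tail_lower_le a1 M0 m0 mhp hp0 hple.
have T3 := tail_opposite_le a1 M0 m0 mhm hm0 hmM hmlc Ihm.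
have -> : (\int[mu]_(u in `[0%R, +oo[) (`|u - m| `^ alpha * hp u)%:E =
    \int[mu]_(u in `[0%R, +oo[) (Num.max (u - m) 0 `^ alpha * hp u)%:E +
    \int[mu]_(u in `[0%R, +oo[) (Num.max (m - u) 0 `^ alpha * hp u)%:E)%E.
  rewrite -ge0_integralD//; last 4 first.
  - by move=> u _; rewrite lee_fin mulr_ge0 ?powR_ge0.
  - apply/measurable_EFinP/measurable_funTS/measurable_funM => //.
    apply: (@measurableT_comp _ _ _ _ _ _ (@powR R ^~ alpha)); first exact: measurable_powR.
    by apply: measurable_maxr => //; exact: measurable_funB.
  - by move=> u _; rewrite lee_fin mulr_ge0 ?powR_ge0.
  - apply/measurable_EFinP/measurable_funTS/measurable_funM => //.
    apply: (@measurableT_comp _ _ _ _ _ _ (@powR R ^~ alpha)); first exact: measurable_powR.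
    by apply: measurable_maxr => //; exact: measurable_funB.
  apply: eq_integral => u _; rewrite -EFinD -mulrDl; congr (_ * _)%:E.
  have [um|mu] := leP u m.
    rewrite (max_idPr _) ?subr_le0// (max_idPl _) ?subr_ge0//.
    by rewrite powR0 ?gt_eqF// add0r distrC ger0_norm// subr_ge0.
  rewrite (max_idPl _) ?subr_ge0 ?(ltW mu)// (max_idPr _) ?subr_le0 ?(ltW mu)//.
  by rewrite powR0 ?gt_eqF// addr0 ger0_norm// subr_ge0 ltW.
apply: le_trans (leeD (leeD (T1 mq0) T2) T3) _; rewrite -!EFinD lee_fin.
have Ma0 : 0 < M `^ alpha by exact: powR_gt0.
rewrite ler_pdivlMr//.
have nq : M * m <= q ^+ 2 by rewrite mulrC -ler_pdivlMr.
have := moment_bound_scaled a1 (Gamma_ge1 a1) q0 p0 qp (mulr_ge0 (ltW M0) m0) nq.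
apply: le_trans.
have Ea : (q / M) `^ alpha * M `^ alpha = q `^ alpha.
  by rewrite -powRM ?divr_ge0 ?(ltW M0)// divfK// gt_eqF.
have EM : M `^ alpha = M * M `^ (alpha - 1) by rewrite mulr_powRB1// ltW.
have Em : (M * m) `^ (alpha - 1) = M `^ (alpha - 1) * m `^ (alpha - 1).
  by rewrite powRM// ltW.
have Ep : (p + M * m) `^ (alpha - 1) = M `^ (alpha - 1) * (p / M + m) `^ (alpha - 1).
  rewrite -powRM ?(ltW M0) ?addr_ge0 ?divr_ge0 ?(ltW M0)//; congr (_ `^ _).
  by field; rewrite gt_eqF.
rewrite Em Ep -Ea EM le_eqVlt; apply/orP; left; apply/eqP.
by field; rewrite gt_eqF.
Qed.

(** The position of the mean [m] enters through positive parts, so that every integrand is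
    nonnegative. According to the side of [x0] on which [m] lies, the right or the left half of [f]
    plays the part of [hp]. *)
Lemma logconcave_moment_le (alpha x0 m : R) (f : R -> R) :
  1 <= alpha -> is_pdf f -> log_concave f -> 0 < f x0 ->
  (forall x, f x <= 11 / 10 * f x0) ->
  ((m - x0)%:E <= \int[mu]_x (Num.max (x - x0) 0 * f x)%:E)%E ->
  ((x0 - m)%:E <= \int[mu]_x (Num.max (x0 - x) 0 * f x)%:E)%E ->
  (\int[mu]_x (`|x - m| `^ alpha * f x)%:E <=
   (Gamma (alpha + 1) / f x0 `^ alpha)%:E)%E.
Proof.
move=> a1 [mf f0 If] flc fx0 fle mR mL.
have a0 : 0 < alpha by lra.
pose hr u := f (x0 + u); pose hl u := f (x0 - u).
have mhr : measurable_fun [set: R] hr by apply: measurableT_comp => //; exact: measurable_funD.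
have mhl : measurable_fun [set: R] hl by apply: measurableT_comp => //; exact: measurable_funB.
have hrlc u t : 0 <= u -> 0 <= t <= 1 -> hr u `^ t * f x0 `^ (1 - t) <= hr (t * u).
  move=> _ t01; have := flc (x0 + u) x0 t t01.
  by rewrite (_ : t * (x0 + u) + (1 - t) * x0 = x0 + t * u)//; ring.
have hllc u t : 0 <= u -> 0 <= t <= 1 -> hl u `^ t * f x0 `^ (1 - t) <= hl (t * u).
  move=> _ t01; have := flc (x0 - u) x0 t t01.
  by rewrite (_ : t * (x0 - u) + (1 - t) * x0 = x0 - t * u)//; ring.
have hr0 : hr 0 = f x0 by rewrite /hr addr0.
have hl0 : hl 0 = f x0 by rewrite /hl subr0.
have split (F : R -> R) : measurable_fun [set: R] F -> (forall x, 0 <= F x) ->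
    (\int[mu]_x (F x * f x)%:E = \int[mu]_(u in `[0%R, +oo[) (F (x0 + u)%R * hr u)%:E +
     \int[mu]_(u in `[0%R, +oo[) (F (x0 - u)%R * hl u)%:E)%E.
  move=> mF F0; apply: (@ge0_integral_setT_split _ x0 (fun x => (F x * f x)%:E)).
  - by apply/measurable_EFinP; exact: measurable_funM.
  - by move=> x; rewrite lee_fin mulr_ge0.
have Ihr0 : (0 <= \int[mu]_(u in `[0%R, +oo[) (hr u)%:E)%E.
  by apply: integral_ge0 => u _; rewrite lee_fin f0.
have Ihl0 : (0 <= \int[mu]_(u in `[0%R, +oo[) (hl u)%:E)%E.
  by apply: integral_ge0 => u _; rewrite lee_fin f0.
have qp : (\int[mu]_(u in `[0%R, +oo[) (hr u)%:E +
           \int[mu]_(u in `[0%R, +oo[) (hl u)%:E = 1)%E.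
  rewrite -If (@ge0_integral_setT_split _ x0 (fun x => (f x)%:E))//.
  - exact/measurable_EFinP.
have Ihr : (\int[mu]_(u in `[0%R, +oo[) (hr u)%:E =
    (fine (\int[mu]_(u in `[0%R, +oo[) (hr u)%:E))%:E)%E.
  rewrite fineK// ge0_fin_numE//; apply: (@le_lt_trans _ _ 1%E); last exact: ltry.
  by rewrite -qp leeDl.
have Ihl : (\int[mu]_(u in `[0%R, +oo[) (hl u)%:E =
    (fine (\int[mu]_(u in `[0%R, +oo[) (hl u)%:E))%:E)%E.
  rewrite fineK// ge0_fin_numE//; apply: (@le_lt_trans _ _ 1%E); last exact: ltry.
  by rewrite -qp leeDr.
have qp1 : fine (\int[mu]_(u in `[0%R, +oo[) (hr u)%:E) +
           fine (\int[mu]_(u in `[0%R, +oo[) (hl u)%:E) = 1.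
  by apply: EFin_inj; rewrite EFinD -Ihr -Ihl.
have mabs : measurable_fun [set: R] (fun x => `|x - m| `^ alpha).
  apply: (@measurableT_comp _ _ _ _ _ _ (@powR R ^~ alpha)); first exact: measurable_powR.
  by apply: measurableT_comp => //; exact: measurable_funB.
rewrite split//.
have [x0m|mx0] := leP x0 m.
  have m0 : 0 <= m - x0 by rewrite subr_ge0.
  have mI : ((m - x0)%:E <= \int[mu]_(u in `[0%R, +oo[) (u * hr u)%:E)%E.
    apply: le_trans mR _; rewrite (split (fun x => Num.max (x - x0) 0)); last 2 first.
    - by apply: measurable_maxr => //; exact: measurable_funB.
    - by move=> x; rewrite le_max lexx orbT.
    rewrite [X in (_ + X)%E]integral0_eq ?adde0; last first.
      by move=> u /Dge u0; rewrite (max_idPr _) ?mul0r// addrAC subrr add0r oppr_le0.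
    rewrite le_eqVlt; apply/orP; left; apply/eqP; apply: eq_integral => u.
    by rewrite inE => /Dge u0; rewrite addrAC subrr add0r (max_idPl _).
  have := two_sided_moment_bound a1 fx0 m0 mhr mhl (fun u => f0 _) (fun u => f0 _)
    hr0 hl0 hrlc hllc Ihr Ihl qp1 (fun u _ => fle _) mI.
  apply: le_trans; apply: leeD.
  - rewrite le_eqVlt; apply/orP; left; apply/eqP; apply: eq_integral => u _.
    by congr (`|_| `^ _ * _)%:E; ring.
  - rewrite le_eqVlt; apply/orP; left; apply/eqP; apply: eq_integral => u.
    rewrite inE => /Dge u0; congr (_ `^ _ * _)%:E.
    by rewrite distrC ger0_norm; lra.
have m0 : 0 <= x0 - m by rewrite subr_ge0 ltW.
have mI : ((x0 - m)%:E <= \int[mu]_(u in `[0%R, +oo[) (u * hl u)%:E)%E.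
  apply: le_trans mL _; rewrite (split (fun x => Num.max (x0 - x) 0)); last 2 first.
  - by apply: measurable_maxr => //; exact: measurable_funB.
  - by move=> x; rewrite le_max lexx orbT.
  rewrite [X in (X + _)%E]integral0_eq ?add0e; last first.
    by move=> u /Dge u0; rewrite (max_idPr _) ?mul0r//; lra.
  rewrite le_eqVlt; apply/orP; left; apply/eqP; apply: eq_integral => u.
  by rewrite inE => /Dge u0; rewrite subKr (max_idPl _).
have qp1' := qp1; rewrite addrC in qp1'.
have := two_sided_moment_bound a1 fx0 m0 mhl mhr (fun u => f0 _) (fun u => f0 _)
  hl0 hr0 hllc hrlc Ihl Ihr qp1' (fun u _ => fle _) mI.
apply: le_trans; rewrite addeC; apply: leeD.
- rewrite le_eqVlt; apply/orP; left; apply/eqP; apply: eq_integral => u _.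
  by rewrite distrC; congr (`|_| `^ _ * _)%:E; ring.
- rewrite le_eqVlt; apply/orP; left; apply/eqP; apply: eq_integral => u.
  rewrite inE => /Dge u0; congr (_ `^ _ * _)%:E.
  by rewrite ger0_norm; lra.
Qed.

End two_sided_moment_bound.

(** * Boundedness and approximate modes of log-concave densities *)

Section logconcave_mode.
Context {R : realType}.
Local Notation mu := (@lebesgue_measure R).
Variable f : R -> R.
Hypothesis pdff : is_pdf f.

Lemma is_pdf_pos_neq (a : R) : exists b, b != a /\ 0 < f b.
Proof.
have [mf f0 If] := pdff.
apply: contrapT => Nb.
have fz x : x != a -> f x = 0.
  move=> xa; apply/eqP; rewrite eq_le f0 andbT leNgt; apply/negP => fx.
  by apply: Nb; exists x.
have : (\int[mu]_(x in [set: R] `\ a) (f x)%:E = 1)%E.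
  have mD : measurable ([set: R] `\ a) by exact: measurableD.
  rewrite integral_setD1//.
  exact/measurable_EFinP/measurable_funTS.
rewrite integral0_eq; last by move=> x [_ /eqP xa]; rewrite fz.
by move/eqP; rewrite eq_sym onee_eq0.
Qed.

Hypothesis flc : log_concave f.

(** On the half of the segment from [z] to [y] nearer to [y], log-concavity keeps [f] above the
    geometric mean r of [f y] and [c]. Mass 1 gives r |y - z| / 2 <= 1, which is then squared. *)
Lemma logconcave_le_far (y z c : R) : 0 < c -> c <= f z -> c <= f y -> y != z ->
  f y <= 4 / (c * (y - z) ^+ 2).
Proof.
have [mf f0 If] := pdff.
move=> c0 cz cy yz.
set r := (f y * c) `^ 2^-1.
have fy0 : 0 < f y by lra.
have rE : r ^+ 2 = f y * c.
  by rewrite -powR_mulrn ?powR_ge0// -powRrM mulVf ?powRr1// mulr_ge0// ltW.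
have fge (t : R) : 2^-1 <= t <= 1 -> r <= f (t * y + (1 - t) * z).
  move=> /andP[t0 t1]; apply: (le_trans _ (flc y z _)); last by rewrite t1 andbT; lra.
  apply: (@le_trans _ _ (f y `^ t * c `^ (1 - t))); last first.
    by rewrite ler_wpM2l ?powR_ge0// ge0_ler_powR ?nnegrE ?subr_ge0//; lra.
  rewrite /r powRM ?(ltW fy0) ?(ltW c0)//.
  have -> : f y `^ t = f y `^ 2^-1 * f y `^ (t - 2^-1).
    by rewrite -powRD ?(gt_eqF fy0) ?implybT// addrC subrK.
  have -> : c `^ 2^-1 = c `^ (t - 2^-1) * c `^ (1 - t).
    rewrite -powRD ?(gt_eqF c0) ?implybT//; congr (_ `^ _).
    by lra.
  rewrite -mulrA ler_wpM2l ?powR_ge0// ler_wpM2r ?powR_ge0// ge0_ler_powR ?nnegrE//; lra.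
have key (l w : R) : 0 <= w -> (forall x : R, l <= x <= l + w -> r <= f x) -> r * w <= 1.
  move=> w0 H; rewrite -lee_fin -If.
  apply: (@le_trans _ _ (\int[mu]_(x in `[l, (l + w)%R]) (f x)%:E)%E); last first.
    apply: ge0_subset_integral => //; first exact/measurable_EFinP.
    by move=> x _; rewrite lee_fin.
  apply: (@le_trans _ _ (\int[mu]_(x in `[l, (l + w)%R]) (cst r%:E x))%E).
    rewrite integral_cst//= lebesgue_measure_itv/= lte_fin ltrDl.
    move: w0; rewrite le_eqVlt => /predU1P[<-|w0].
      by rewrite mulr0 ltxx mule0.
    by rewrite w0 -EFinB addrAC subrr add0r -EFinM lexx.
  apply: ge0_le_integral => //=.
  - by move=> x _; rewrite lee_fin powR_ge0.
  - exact/measurable_EFinP/measurable_funTS.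
have rw : r * (`|y - z| / 2) <= 1.
  have [zy|yz'] := leP z y.
    rewrite ger0_norm ?subr_ge0//; apply: (key ((y + z) / 2)); first by lra.
    move=> x /andP[x1 x2].
    have d0 : 0 < y - z by rewrite subr_gt0 lt_neqAle eq_sym yz.
    have -> : x = (x - z) / (y - z) * y + (1 - (x - z) / (y - z)) * z by field; rewrite gt_eqF.
    by apply: fge; rewrite ler_pdivrMr// ler_pdivlMr//; lra.
  rewrite ltr0_norm ?subr_lt0//; apply: (key y); first by lra.
  move=> x /andP[x1 x2].
  have d0 : 0 < z - y by lra.
  have -> : x = (z - x) / (z - y) * y + (1 - (z - x) / (z - y)) * z by field; rewrite gt_eqF.
  by apply: fge; rewrite ler_pdivrMr// ler_pdivlMr//; lra.
have d0 : 0 < (y - z) ^+ 2 by rewrite exprn_even_gt0//= subr_eq0.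
have cd0 : 0 < c * (y - z) ^+ 2 by exact: mulr_gt0.
rewrite (ler_pdivlMr _ _ cd0) mulrA -rE -(real_normK (num_real (y - z))) -exprMn.
have r0 : 0 <= r * `|y - z| by rewrite mulr_ge0 ?powR_ge0.
have : r * `|y - z| <= 2 by lra.
nra.
Qed.

(** Take two points where [f] is positive; every x is at least half their distance away from one of
    them. Halving the distance turns the 4 of [logconcave_le_far] into 16. *)
Lemma logconcave_bounded : exists B, forall x, f x <= B.
Proof.
have [mf f0 If] := pdff.
have [a [_ fa]] := is_pdf_pos_neq 0.
have [b [ba fb]] := is_pdf_pos_neq a.
pose c := Num.min (f a) (f b).
have c0 : 0 < c by rewrite lt_min fa fb.
have d0 : 0 < (b - a) ^+ 2 by rewrite exprn_even_gt0//= subr_eq0.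
exists (Num.max c (16 / (c * (b - a) ^+ 2))) => x.
rewrite le_max; have [//|cx] := leP (f x) c; apply/orP; right.
have far (z : R) : c <= f z -> (b - a) ^+ 2 <= 4 * (x - z) ^+ 2 ->
    f x <= 16 / (c * (b - a) ^+ 2).
  move=> cz xz.
  have xz0 : x != z.
    by apply/eqP => xz0; move: xz; rewrite xz0 subrr expr0n/= mulr0 leNgt d0.
  have xz2 : 0 < (x - z) ^+ 2 by rewrite exprn_even_gt0//= subr_eq0.
  apply: le_trans (logconcave_le_far c0 cz (ltW cx) xz0) _.
  have c1 : 0 < c * (x - z) ^+ 2 by exact: mulr_gt0.
  have c2 : 0 < c * (b - a) ^+ 2 by exact: mulr_gt0.
  rewrite (ler_pdivrMr _ _ c1) mulrAC (ler_pdivlMr _ _ c2).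
  have := ler_wpM2l (ltW c0) xz; lra.
have [H|H] := leP ((b - a) ^+ 2) (4 * (x - a) ^+ 2).
  by apply: far H; rewrite ge_min lexx.
apply: (far b); rewrite ?ge_min ?lexx ?orbT//.
have := sqr_ge0 (2 * (x - a) - (b - a)); nra.
Qed.

Lemma logconcave_near_mode (x1 : R) : 0 < f x1 ->
  exists x0, f x1 <= f x0 /\ forall x, f x <= 11 / 10 * f x0.
Proof.
move=> fx1; have [B fB] := logconcave_bounded.
have supf : has_sup (range f).
  by split; [exists (f 0), 0|exists B => _ [x _ <-]].
have fS x : f x <= sup (range f) by apply: (ub_le_sup supf.2); exists x.
have [H|H] := leP (sup (range f)) (11 / 10 * f x1).
  by exists x1; split=> // x; exact: le_trans H.
have S0 : 0 < sup (range f) by lra.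
(* Exceeding 10/11 of the supremum gives the factor 11/10, and also beats [f x1], which lies below
   10/11 of it in this case. *)
have [_ [x0 _ <-] fx0] : exists2 y, range f y & sup (range f) - sup (range f) / 11 < y.
  by apply: sup_adherent => //; rewrite divr_gt0.
exists x0; split; first lra.
by move=> x; have := fS x; lra.
Qed.

End logconcave_mode.

(** * The generalized Gaussian and the lower bound *)

Section max_entropy.
Context {R : realType}.
Local Notation mu := (@lebesgue_measure R).

Lemma constC_gt0 (alpha : R) : 1 <= alpha -> 0 < constC alpha.
Proof.
move=> a1; have a0 : 0 < alpha by lra.
by rewrite /constC !mulr_gt0 ?invr_gt0 ?GammaV_gt0 ?powR_gt0 ?mulr_gt0 ?expR_gt0.
Qed.

Lemma measurable_generalized_gaussian (alpha s m : R) :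
  measurable_fun [set: R] (fun x => expR (- (`|x - m| `^ alpha / (alpha * s `^ alpha)))).
Proof.
do 2 apply: measurableT_comp => //; apply: measurable_funM => //.
apply: (@measurableT_comp _ _ _ _ _ _ (@powR R ^~ alpha)); first exact: measurable_powR.
by apply: measurableT_comp => //; exact: measurable_funB.
Qed.

(** Rescaling by b with b^alpha = alpha s^alpha. The normalized density has entropy equal to the
    logarithm of this integral plus 1/alpha, so [constC alpha * s] is the exponential of the maximal
    entropy. *)
Lemma integral_generalized_gaussian (alpha s m : R) : 1 <= alpha -> 0 < s ->
  (\int[mu]_x (expR (- (`|x - m| `^ alpha / (alpha * s `^ alpha))))%:E =
   (constC alpha * s / expR alpha^-1)%:E)%E.
Proof.
move=> a1 s0; have a0 : 0 < alpha by lra.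
pose b := s * alpha `^ alpha^-1.
have b0 : 0 < b by rewrite mulr_gt0 ?powR_gt0.
have ba : b `^ alpha = alpha * s `^ alpha.
  by rewrite powRM ?powR_ge0 ?(ltW s0)// powRVK ?gt_eqF ?(ltW a0)// mulrC.
have half : (\int[mu]_(u in `[0%R, +oo[) (expR (- (u `^ alpha / (alpha * s `^ alpha))))%:E =
    (b * (alpha^-1 * Gamma alpha^-1))%:E)%E.
  rewrite (@ge0_integral_scale _ b (fun u => (expR (- (u `^ alpha / (alpha * s `^ alpha))))%:E))//.
  - rewrite [in RHS]EFinM -(integral_expR_powR a1); congr (_ * _)%E; apply: eq_integral => u.
    rewrite inE/= in_itv/= andbT => u0; rewrite powRM ?(ltW b0)// ba mulrAC divff ?mul1r//.
    by rewrite gt_eqF// mulr_gt0// powR_gt0.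
  - apply/measurable_EFinP; do 2 apply: measurableT_comp => //; apply: measurable_funM => //.
rewrite (@ge0_integral_setT_split _ m
   (fun x => (expR (- (`|x - m| `^ alpha / (alpha * s `^ alpha))))%:E))//; last first.
  by apply/measurable_EFinP; exact: measurable_generalized_gaussian.
rewrite (_ : \int[mu]_(u in _) _ = (b * (alpha^-1 * Gamma alpha^-1))%:E)%E; last first.
  rewrite -half; apply: eq_integral => u; rewrite inE/= in_itv/= andbT => u0.
  by rewrite addrAC subrr add0r ger0_norm.
rewrite (_ : \int[mu]_(u in _) _ = (b * (alpha^-1 * Gamma alpha^-1))%:E)%E; last first.
  rewrite -half; apply: eq_integral => u; rewrite inE/= in_itv/= andbT => u0.
  by rewrite addrAC subrr add0r normrN ger0_norm.
rewrite -EFinD; congr EFin; rewrite /constC /b powRM ?expR_ge0 ?(ltW a0)//.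
rewrite -expRM mul1r; field.
by rewrite gt_eqF ?expR_gt0// gt_eqF.
Qed.

(* Gibbs' inequality [t ln (t / y) >= t - y], combined with
   [t `^ (p - 1) >= 1 + (p - 1) * ln t]. *)
Lemma tangent_log_bound (K y c w p : R) : 0 < K -> 0 <= y -> 1 <= p ->
  y + (p - 1) * ((c + 1) * y) <=
  y * (K * y) `^ (p - 1) + (p - 1) * (y * w + expR c / K * expR (- w)).
Proof.
move=> K0 y0 p1.
have p10 : 0 <= p - 1 by rewrite subr_ge0.
have eK : 0 < expR c / K * expR (- w) by rewrite mulr_gt0 ?divr_gt0 ?expR_gt0.
move: y0; rewrite le_eqVlt => /predU1P[<-|y0].
  by rewrite !mul0r !mulr0 !add0r mulr_ge0// ltW.
have Ky : 0 < K * y by rewrite mulr_gt0.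
have H1 : 1 + (p - 1) * ln (K * y) <= (K * y) `^ (p - 1).
  by rewrite /powR gt_eqF// expR_ge1Dx.
have H2 : c - w - ln (K * y) + 1 <= expR c / K * expR (- w) / y.
  have -> : expR c / K * expR (- w) / y = expR (c - w - ln (K * y)).
    rewrite expRB expRB lnK ?posrE// expRN; field.
    by rewrite !gt_eqF// expR_gt0.
  by rewrite addrC expR_ge1Dx.
move: H2; rewrite ler_pdivlMr// => H2.
have := ler_wpM2l (ltW y0) H1; have := ler_wpM2l p10 H2; nra.
Qed.

Lemma integral_powR_ge (alpha s m p : R) (f : R -> R) : 1 <= alpha -> 0 < s ->
  is_pdf f -> (\int[mu]_x (`|x - m| `^ alpha * f x)%:E = (s `^ alpha)%:E)%E ->
  1 <= p ->
  (((constC alpha * s) `^ (1 - p))%:E <= \int[mu]_x (f x `^ p)%:E)%E.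
Proof.
move=> a1 s0 [mf f0 If] fs p1.
have a0 : 0 < alpha by lra.
have p0 : 0 < p by lra.
have p10 : 0 <= p - 1 by lra.
set K := constC alpha * s.
have K0 : 0 < K by rewrite mulr_gt0// constC_gt0.
pose c := alpha^-1; have c0 : 0 < c by rewrite invr_gt0.
have as0 : 0 < alpha * s `^ alpha by rewrite mulr_gt0// powR_gt0.
have mfp : measurable_fun [set: R] (fun x => f x `^ p).
  by apply: (@measurableT_comp _ _ _ _ _ _ (@powR R ^~ p)) => //; exact: measurable_powR.
have mabs : measurable_fun [set: R] (fun x => `|x - m| `^ alpha * f x).
  apply: measurable_funM => //.
  apply: (@measurableT_comp _ _ _ _ _ _ (@powR R ^~ alpha)); first exact: measurable_powR.
  by apply: measurableT_comp => //; exact: measurable_funB.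
have mg := measurable_generalized_gaussian alpha s m.
set g := fun x => expR (- (`|x - m| `^ alpha / (alpha * s `^ alpha))) in mg *.
have k2 : 0 <= (p - 1) / (alpha * s `^ alpha) by rewrite divr_ge0// ltW.
have k3 : 0 <= (p - 1) * (expR c / K) by rewrite mulr_ge0// divr_ge0 ?expR_ge0 ?ltW.
have k1 : 0 <= K `^ (p - 1) by exact: powR_ge0.
have k4 : 0 <= 1 + (p - 1) * (c + 1) by rewrite addr_ge0// mulr_ge0// addr_ge0// ltW.
have : ((1 + (p - 1) * (c + 1))%:E * \int[mu]_x (f x)%:E <=
   (K `^ (p - 1))%:E * \int[mu]_x (f x `^ p)%:E +
   (((p - 1) / (alpha * s `^ alpha))%:E * \int[mu]_x (`|x - m| `^ alpha * f x)%:E +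
    ((p - 1) * (expR c / K))%:E * \int[mu]_x (g x)%:E))%E.
  rewrite -!ge0_integralZl_EFin//; try by [
    apply/measurable_EFinP | move=> x _; rewrite lee_fin ?mulr_ge0 ?powR_ge0 ?expR_ge0].
  rewrite -ge0_integralD//; last 4 first.
  - by move=> x _; rewrite -EFinM lee_fin mulr_ge0// mulr_ge0 ?powR_ge0.
  - by apply/measurable_EFinP; exact: measurable_funM.
  - by move=> x _; rewrite -EFinM lee_fin mulr_ge0// expR_ge0.
  - by apply/measurable_EFinP; exact: measurable_funM.
  rewrite -ge0_integralD//; last 4 first.
  - by move=> x _; rewrite -EFinM lee_fin mulr_ge0// powR_ge0.
  - by apply/measurable_EFinP; exact: measurable_funM.
  - move=> x _; rewrite -!EFinM -EFinD lee_fin addr_ge0 ?mulr_ge0 ?powR_ge0 ?expR_ge0//.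
    + by rewrite invr_ge0 ltW.
    + by rewrite invr_ge0 ltW.
  - by apply/measurable_EFinP; apply: measurable_funD; exact: measurable_funM.
  apply: ge0_le_integral => //.
  - by move=> x _; rewrite -EFinM lee_fin mulr_ge0.
  - by apply/measurable_EFinP; exact: measurable_funM.
  - apply/measurable_EFinP; apply: measurable_funD; first exact: measurable_funM.
    by apply: measurable_funD; exact: measurable_funM.
  - move=> x _; rewrite -!EFinM -!EFinD lee_fin.
    have := tangent_log_bound c (`|x - m| `^ alpha / (alpha * s `^ alpha)) K0 (f0 x) p1.
    rewrite powRM ?(ltW K0)// -(mulr_powRB1 (f0 x) p0) /g.
    set V := `|x - m| `^ alpha; set S := alpha * s `^ alpha; set B := expR (- (V / S)).
    have -> : (p - 1) * (f x * (V / S) + expR c / K * B) =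
      (p - 1) / S * (V * f x) + (p - 1) * (expR c / K) * B.
      by field; rewrite !gt_eqF.
    lra.
(* With c = 1/alpha the moment term integrates to (p - 1) c and the Gaussian term to p - 1; together
   they cancel the surplus (p - 1)(c + 1) on the left, leaving 1. *)
rewrite If fs integral_generalized_gaussian// -/K -/c mule1 -!EFinM -EFinD.
have -> : (p - 1) / (alpha * s `^ alpha) * s `^ alpha +
    (p - 1) * (expR c / K) * (K / expR c) = (p - 1) * (c + 1).
  by rewrite /c; field; rewrite !gt_eqF ?powR_gt0 ?expR_gt0.
rewrite EFinD leeD2rE// => H.
rewrite (_ : 1 - p = - (p - 1)); last by rewrite opprB.
rewrite powRN -(@lee_pmul2l _ (K `^ (p - 1))%:E)//; last by rewrite lte_fin powR_gt0.
by rewrite -EFinM divff// gt_eqF// powR_gt0.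
Qed.

End max_entropy.

(** * From the random variable to the pointwise bound on its density *)

Section random_variable.
Context d (T : measurableType d) (R : realType) (P : probability T R).
Variables (X : {RV P >-> R}) (f : R -> R).
Hypothesis Xf : has_pdf X f.
Local Notation mu := (@lebesgue_measure R).

Lemma integral_has_pdf (phi : R -> R) : measurable_fun [set: R] phi ->
  (forall x, 0 <= phi x) ->
  (\int[P]_w (phi (X w))%:E = \int[mu]_x (phi x * f x)%:E)%E.
Proof.
move=> mphi phi0; have [[mf f0 _] fE] := Xf.
have mE : measurable_fun [set: R] (EFin \o phi) by exact/measurable_EFinP.
have E0 x : (0 <= (EFin \o phi) x)%E by rewrite lee_fin.
have mX0 : measurable_fun [set: T] X by exact: measurable_funP.
have mX : measurable_fun [set: T] (X : T -> measurableTypeR R) by exact: mX0.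
pose nu' := (pushforward P (X : T -> measurableTypeR R) : measure _ R).
pose nu := nu' mX.
transitivity (\int[nu]_x (EFin \o phi) x)%E.
  by rewrite ge0_integral_pushforward.
have nuE (A : set (measurableTypeR R)) : measurable A ->
    nu A = (\int[mu]_(x in A) (f x)%:E)%E by move=> mA; exact: fE.
by rewrite (@ge0_integral_density _ _ _ mu nu f mf f0 nuE _ mE E0).
Qed.

Variable alpha : R.
Hypotheses (alpha1 : 1 <= alpha) (sigma_fin : (sigma X alpha < +oo)%E).
Let m := fine ('E_P[X])%E.
Let s := fine (sigma X alpha).

Let alpha0 : 0 < alpha. Proof. exact: lt_le_trans alpha1. Qed.

Let mabs : measurable_fun [set: R] (fun x => `|x - m| `^ alpha).
Proof.
apply: (@measurableT_comp _ _ _ _ _ _ (@powR R ^~ alpha)); first exact: measurable_powR.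
by apply: measurableT_comp => //; exact: measurable_funB.
Qed.

Let sigmaE : sigma X alpha = ((\int[mu]_x (`|x - m| `^ alpha * f x)%:E) `^ alpha^-1)%E.
Proof.
by rewrite /sigma -(integral_has_pdf mabs) ?/m; [rewrite unlock|move=> x; exact: powR_ge0].
Qed.

Let moment_lty : (\int[mu]_x (`|x - m| `^ alpha * f x)%:E < +oo)%E.
Proof.
move: sigma_fin; rewrite sigmaE; apply: lty_poweRy.
by rewrite invr_neq0// gt_eqF.
Qed.

Let moment_ge0 : (0 <= \int[mu]_x (`|x - m| `^ alpha * f x)%:E)%E.
Proof.
have [[_ f0 _] _] := Xf.
by apply: integral_ge0 => x _; rewrite lee_fin mulr_ge0 ?powR_ge0.
Qed.

Lemma central_moment_sigma :
  (\int[mu]_x (`|x - m| `^ alpha * f x)%:E = (s `^ alpha)%:E)%E.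
Proof.
rewrite /s sigmaE fine_poweR powRVK ?gt_eqF ?fine_ge0// fineK//.
by rewrite ge0_fin_numE.
Qed.

(** If the moment were zero, multiplying its integrand by |x - m|^(-alpha) would recover [f] off [m]
    and give total mass zero. The default value of the inverse power at [m] is harmless, a point
    being negligible. *)
Lemma sigma_gt0 : 0 < s.
Proof.
have [[mf f0 If] _] := Xf.
rewrite lt_neqAle eq_sym; apply/andP; split; last first.
  by rewrite /s sigmaE fine_ge0// poweR_ge0.
apply/eqP => s0; have := central_moment_sigma.
rewrite s0 powR0 ?gt_eqF// => I0.
pose phi x := `|x - m| `^ (- alpha).
have mphi : measurable_fun [set: R] phi.
  apply: (@measurableT_comp _ _ _ _ _ _ (@powR R ^~ (- alpha))); first exact: measurable_powR.
  by apply: measurableT_comp => //; exact: measurable_funB.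
have mk : measurable_fun [set: R] (fun x => `|x - m| `^ alpha * f x) by exact: measurable_funM.
have phi0 (x : R) : 0 <= phi x by exact: powR_ge0.
have k0 (x : R) : 0 <= `|x - m| `^ alpha * f x by rewrite mulr_ge0 ?powR_ge0.
have := @ge0_integralM_eq0 R setT phi _ measurableT mphi mk (fun x _ => phi0 x) (fun x _ => k0 x) I0.
have mD : measurable ([set: R] `\ m) by exact: measurableD.
rewrite -(integral_setD1 (r := m))//; last first.
  by apply/measurable_EFinP/measurable_funTS; exact: measurable_funM.
rewrite (@eq_integral _ _ _ mu _ (fun x => (f x)%:E)); last first.
  move=> x; rewrite inE => -[_ /= /eqP xm].
  by rewrite /phi powRN mulrA mulVf ?mul1r// gt_eqF// powR_gt0// normr_gt0 subr_eq0.
rewrite integral_setD1//; last exact/measurable_EFinP/measurable_funTS.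
by rewrite If => /eqP; rewrite onee_eq0.
Qed.

(** At this stage [m] is just the real number [fine] returns, even for an infinite expectation. The
    finite moment about it still yields integrability, as v <= v^alpha + 1 for v >= 0, and only then
    is [m] known to be the mean. *)
Lemma RV_integrable : P.-integrable [set: T] (EFin \o X).
Proof.
have mX : measurable_fun [set: T] X by [].
apply/integrableP; split; first exact/measurable_EFinP.
apply: (@le_lt_trans _ _ (\int[P]_w ((`|X w - m| `^ alpha)%:E + (1 + `|m|)%:E))%E).
  have mXm : measurable_fun [set: T] (fun w => `|X w - m| `^ alpha).
    exact: (measurableT_comp mabs).
  apply: ge0_le_integral => //.
  - by apply/measurable_EFinP; exact: measurableT_comp.
  - by apply/emeasurable_funD => //; exact/measurable_EFinP.
  - move=> w _; rewrite abse_EFin -EFinD lee_fin.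
    have H1 : `|X w| <= `|X w - m| + `|m| by rewrite -{1}(subrK m (X w)) ler_normD.
    have H2 := powR_ge_tangent alpha1 (normr_ge0 (X w - m)).
    have H3 := powR_ge0 `|X w - m| alpha.
    have [v1|v1] := leP `|X w - m| 1; first by lra.
    have a10 : 0 <= alpha - 1 by rewrite subr_ge0.
    have v10 : 0 <= `|X w - m| - 1 by rewrite subr_ge0 ltW.
    have := mulr_ge0 a10 v10; lra.
rewrite ge0_integralD//; last first.
  by apply/measurable_EFinP; exact: (measurableT_comp mabs).
rewrite (integral_has_pdf mabs); last by move=> x; exact: powR_ge0.
rewrite lte_add_pinfty ?moment_lty// integral_cst//=.
by rewrite (probability_setT P) mule1 ltry.
Qed.

Let expectationE : ('E_P[X] = m%:E)%E.
Proof.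
by rewrite /m fineK// unlock; apply: integrable_fin_num => //; exact: RV_integrable.
Qed.

Let expectation_le (Y : R -> R) : measurable_fun [set: R] Y -> (forall x, 0 <= Y x) ->
  forall c k : R, (forall x, c * x + k <= Y x) ->
  ((c * m + k)%:E <= \int[mu]_x (Y x * f x)%:E)%E.
Proof.
move=> mY Y0 c k cY; rewrite -(integral_has_pdf mY)//.
have mX : measurable_fun [set: T] X by exact: measurable_funP.
have iX := RV_integrable.
have icX : P.-integrable [set: T] (fun w => (c%:E * (X w)%:E)%E) by exact: integrableZl.
have ik : P.-integrable [set: T] (EFin \o cst k) by exact: finite_measure_integrable_cst.
have -> : ((c * m + k)%:E = \int[P]_w (c%:E * (X w)%:E + (EFin \o cst k) w))%E.
  rewrite integralD// integralZl//= integral_cst//= (probability_setT P) mule1.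
  by rewrite -expectation_def expectationE -EFinM -EFinD.
(* [Y] may have infinite integral; otherwise both sides are integrable and compare, although the
   affine minorant changes sign. *)
have [Yfin|Yfin] := eqVneq (\int[P]_w (Y (X w))%:E)%E +oo%E; first by rewrite Yfin leey.
apply: le_integral => //.
- exact: integrableD.
- apply/integrableP; split; first by apply/measurable_EFinP; exact: measurableT_comp.
  under eq_integral do rewrite gee0_abs ?lee_fin//.
  by rewrite ltey.
- by move=> w _; rewrite -EFinM -EFinD lee_fin.
Qed.

Lemma mean_sub_le (x0 : R) :
  ((m - x0)%:E <= \int[mu]_x (Num.max (x - x0) 0 * f x)%:E)%E.
Proof.
have -> : m - x0 = 1 * m + - x0 by rewrite mul1r.
apply: (@expectation_le (fun x => Num.max (x - x0) 0)).
- by apply: measurable_maxr => //; exact: measurable_funB.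
- by move=> x; rewrite le_max lexx orbT.
- by move=> x; rewrite mul1r le_max lexx.
Qed.

Lemma mean_sub_ge (x0 : R) :
  ((x0 - m)%:E <= \int[mu]_x (Num.max (x0 - x) 0 * f x)%:E)%E.
Proof.
have -> : x0 - m = -1 * m + x0 by rewrite mulN1r addrC.
apply: (@expectation_le (fun x => Num.max (x0 - x) 0)).
- by apply: measurable_maxr => //; exact: measurable_funB.
- by move=> x; rewrite le_max lexx orbT.
- by move=> x; rewrite mulN1r addrC le_max lexx.
Qed.

(** The moment bound reads (s f(x0))^alpha <= Gamma(alpha + 1) with [f x <= f x0]; it remains to
    take the root. *)
Lemma density_le_constD : log_concave f -> forall x, f x <= constD alpha / s.
Proof.
move=> flc x; have [pf _] := Xf; have [mf f0 If] := pf.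
have s0 := sigma_gt0.
have [fx|fx] := leP (f x) 0.
  by rewrite (le_trans fx)// divr_ge0 ?powR_ge0// ltW.
have [x0 [fx0 fle]] := logconcave_near_mode pf flc fx.
have fx00 : 0 < f x0 by exact: lt_le_trans fx0.
apply: le_trans fx0 _.
have := logconcave_moment_le alpha1 pf flc fx00 fle (mean_sub_le x0) (mean_sub_ge x0).
rewrite central_moment_sigma lee_fin ler_pdivlMr ?powR_gt0// -powRM ?(ltW s0) ?(ltW fx00)//.
move=> H; rewrite ler_pdivlMr// mulrC.
have sf0 : 0 <= s * f x0 by rewrite mulr_ge0 ?ltW.
rewrite -(@powRK _ alpha (s * f x0)) ?gt_eqF// /constD.
by apply: ge0_ler_powR; rewrite ?invr_ge0 ?nnegrE ?powR_ge0 ?(ltW alpha0)// (le_trans _ H)// powR_ge0.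
Qed.

End random_variable.

(** * Norm bounds for all exponents, infinity included *)

Section Lp_norms.
Context {R : realType}.
Local Notation mu := (@lebesgue_measure R).
Variable f : R -> R.
Hypothesis pdff : is_pdf f.

Lemma lebesgue_measure_setT_gt0 : (0 < mu [set: R])%E.
Proof. by rewrite -set_itvNyy lebesgue_measure_itv/= ltry. Qed.

Lemma recip_EFin (p : R) : 0 < p -> recip p%:E = p^-1.
Proof. by move=> p0; rewrite /recip inver gt_eqF. Qed.

Lemma Lp_norm_pdf_EFin (p : R) : 0 < p ->
  Lp_norm p%:E f = ((\int[mu]_x (f x `^ p)%:E) `^ p^-1)%E.
Proof.
have [_ f0 _] := pdff.
move=> p0; rewrite /Lp_norm unlock; congr (_ `^ _)%E; apply: eq_integral => x _ /=.
by rewrite ger0_norm.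
Qed.

Lemma Lp_norm_pdf1 : Lp_norm 1%E f = 1%E.
Proof.
have [_ f0 If] := pdff.
rewrite /Lp_norm Lnorm1 -If; apply: eq_integral => x _ /=.
by rewrite ger0_norm.
Qed.

Lemma Lp_norm_pdf_pinfty : Lp_norm +oo%E f = ess_sup mu (EFin \o f).
Proof.
have [_ f0 If] := pdff.
rewrite /Lp_norm unlock; rewrite lebesgue_measure_setT_gt0.
by congr ess_sup; apply/funext => x /=; rewrite ger0_norm.
Qed.

(** For finite p, f^p <= B^(p - 1) f is integrated with mass 1. *)
Lemma Lp_norm_pdf_le (B : R) (p : \bar R) : 0 < B -> (forall x, f x <= B) ->
  (1 <= p)%E -> (Lp_norm p f <= (B `^ (1 - recip p))%:E)%E.
Proof.
move=> B0 fB; have [mf f0 If] := pdff.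
case: p => [p| |]//; last first.
  move=> _; rewrite Lp_norm_pdf_pinfty /recip invey/= subr0 powRr1 ?(ltW B0)//.
  by apply/ess_supP; apply/nearW => x /=; rewrite lee_fin.
rewrite lee_fin => p1; have p0 : 0 < p by lra.
have p10 : 0 <= p - 1 by lra.
rewrite Lp_norm_pdf_EFin// recip_EFin//.
have -> : 1 - p^-1 = (p - 1) * p^-1 by field; rewrite gt_eqF.
rewrite powRrM -poweR_EFin; apply: gt0_ler_poweR; rewrite ?in_itv/= ?leey ?andbT.
- by rewrite invr_ge0 ltW.
- by apply: integral_ge0 => x _; rewrite lee_fin powR_ge0.
- by rewrite lee_fin powR_ge0.
rewrite -[leRHS]mule1 -If -ge0_integralZl_EFin ?powR_ge0//; last 2 first.
- by move=> x _; rewrite lee_fin.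
- exact/measurable_EFinP.
apply: ge0_le_integral => //.
- by move=> x _; rewrite lee_fin powR_ge0.
- apply/measurable_EFinP; apply: (@measurableT_comp _ _ _ _ _ _ (@powR R ^~ p)) => //; exact: measurable_powR.
- by apply/measurable_EFinP; exact: measurable_funM.
move=> x _; rewrite -EFinM lee_fin -(mulr_powRB1 (f0 x) p0) mulrC ler_wpM2r//.
by rewrite ge0_ler_powR ?nnegrE ?(ltW B0).
Qed.

Lemma Lp_norm_pdf_ge (alpha s m : R) (p : \bar R) : 1 <= alpha -> 0 < s ->
  (\int[mu]_x (`|x - m| `^ alpha * f x)%:E = (s `^ alpha)%:E)%E -> (1 <= p)%E ->
  (((constC alpha * s) `^ (recip p - 1))%:E <= Lp_norm p f)%E.
Proof.
move=> a1 s0 fs; have [mf f0 If] := pdff.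
have K0 : 0 < constC alpha * s by rewrite mulr_gt0// constC_gt0.
case: p => [p| |]//; last first.
  move=> _; rewrite Lp_norm_pdf_pinfty /recip invey/= sub0r.
  have := ess_sup_ge mu (EFin \o f).
  have : (0 <= ess_sup mu (EFin \o f))%E.
    apply: ess_sup_gee; first exact: lebesgue_measure_setT_gt0.
    by apply/nearW => x /=; rewrite lee_fin.
  case: (ess_sup mu (EFin \o f)) => [t| |]//; last by move=> *; exact: leey.
  rewrite lee_fin => t0 ft.
  (* The exponent 2 settles infinity: the integral of f^2 is at least 1 / (C s), and at most the
     essential supremum [t] because [f] has mass 1. *)
  have p2 : 1 <= 2 :> R by rewrite ler1n.
  have := integral_powR_ge a1 s0 pdff fs p2.
  rewrite (_ : 1 - 2 = -1); last lra.
  move=> /le_trans; apply.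
  rewrite -[leRHS]mule1 -If -ge0_integralZl_EFin//; last 2 first.
  - by move=> x _; rewrite lee_fin.
  - exact/measurable_EFinP.
  apply: ae_ge0_le_integral => //.
  - by move=> x _; rewrite lee_fin powR_ge0.
  - apply/measurable_EFinP.
    apply: (@measurableT_comp _ _ _ _ _ _ (@powR R ^~ 2)) => //; exact: measurable_powR.
  - by move=> x _; rewrite -EFinM lee_fin mulr_ge0.
  - by apply/measurable_EFinP; exact: measurable_funM.
  apply: filterS ft => x /=; rewrite !lee_fin => ft _.
  by rewrite powR_mulrn// expr2 ler_wpM2r.
rewrite lee_fin => p1; have p0 : 0 < p by lra.
rewrite Lp_norm_pdf_EFin// recip_EFin//.
have -> : p^-1 - 1 = (1 - p) * p^-1 by field; rewrite gt_eqF.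
rewrite powRrM -poweR_EFin; apply: gt0_ler_poweR; rewrite ?in_itv/= ?leey ?andbT.
- by rewrite invr_ge0 ltW.
- by rewrite lee_fin powR_ge0.
- by apply: integral_ge0 => x _; rewrite lee_fin powR_ge0.
exact: integral_powR_ge pdff fs p1.
Qed.

End Lp_norms.

(** * Combination of the two bounds *)

Theorem corollary1 (R : realType) (alpha : R) (f : R -> R)
    (d : measure_display) (T : measurableType d) (P : probability T R)
    (X : {RV P >-> R}) :
  1 <= alpha ->
  log_concave f ->
  has_pdf X f ->
  (sigma X alpha < +oo)%E ->
  let C := constC alpha in
  let D := constD alpha in
  let s := fine (sigma X alpha) in
  (forall p q : \bar R, (1 <= p)%E -> (1 <= q)%E ->
    ((C `^ (recip p - 1) * D `^ (recip q - 1) * s `^ (recip p - recip q))%:E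
       * Lp_norm q f <= Lp_norm p f)%E /\
    (Lp_norm p f <=
     (C `^ (1 - recip q) * D `^ (1 - recip p) * s `^ (recip p - recip q))%:E
       * Lp_norm q f)%E) /\
  Lp_norm 1%E f = 1%E /\
  (forall p : \bar R, (1 <= p)%E ->
    (((C * s) `^ (recip p - 1))%:E <= Lp_norm p f)%E /\
    (Lp_norm p f <= ((s / D) `^ (recip p - 1))%:E)%E).
Proof.
move=> a1 flc Xf sfin C D s; have [pf _] := Xf.
have s0 : 0 < s := sigma_gt0 Xf a1 sfin.
have C0 : 0 < C := constC_gt0 a1.
have D0 : 0 < D by rewrite powR_gt0// (lt_le_trans ltr01 (Gamma_ge1 a1)).
have lo p : (1 <= p)%E -> (((C * s) `^ (recip p - 1))%:E <= Lp_norm p f)%E.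
  by move=> p1; exact: (Lp_norm_pdf_ge pf a1 s0 (central_moment_sigma Xf a1 sfin) p1).
have hi p : (1 <= p)%E -> (Lp_norm p f <= ((s / D) `^ (recip p - 1))%:E)%E.
  move=> p1; have -> : (s / D) `^ (recip p - 1) = (D / s) `^ (1 - recip p).
    have Ds0 : 0 <= D / s by rewrite divr_ge0 ?ltW.
    by rewrite -(invf_div D s) -(powR_inv1 Ds0) -powRrM mulN1r opprB.
  apply: Lp_norm_pdf_le p1 => //; first by rewrite divr_gt0.
  exact: (density_le_constD Xf a1 sfin flc).
split; last by split; [exact: Lp_norm_pdf1|move=> p p1; split; [exact: lo|exact: hi]].
have sB (a b c : R) : s `^ (a - b) * s `^ (b - c) = s `^ (a - c).
  by rewrite -powRD ?(gt_eqF s0) ?implybT// addrA subrK.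
move=> p q p1 q1; split.
  apply: le_trans (lo _ p1).
  apply: le_trans (lee_wpmul2l _ (hi _ q1)) _; first by rewrite lee_fin !mulr_ge0 ?powR_ge0.
  (* The powers of [D] cancel, and the exponents of [s] telescope through [recip q]. *)
  rewrite -EFinM lee_fin (powRM _ (ltW C0) (ltW s0)) -(sB (recip p) (recip q) 1).
  have -> : s `^ (recip q - 1) = D `^ (recip q - 1) * (s / D) `^ (recip q - 1).
    by rewrite -powRM ?divr_ge0 ?(ltW D0) ?(ltW s0)// mulrC divfK// gt_eqF.
  by rewrite le_eqVlt; apply/orP; left; apply/eqP; ring.
apply: le_trans (hi _ p1) _.
apply: le_trans (lee_wpmul2l _ (lo _ q1)); last by rewrite lee_fin !mulr_ge0 ?powR_ge0.
rewrite -EFinM lee_fin (powRM _ (ltW C0) (ltW s0)).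
have -> : (s / D) `^ (recip p - 1) = D `^ (1 - recip p) * s `^ (recip p - 1).
  have -> : D `^ (1 - recip p) = D^-1 `^ (recip p - 1).
    by rewrite -(powR_inv1 (ltW D0)) -powRrM mulN1r opprB.
  by rewrite -powRM ?invr_ge0 ?(ltW D0) ?(ltW s0)// mulrC.
rewrite -(sB (recip p) (recip q) 1).
(* On this side it is the powers of [C] that cancel. *)
have CC : C `^ (1 - recip q) * C `^ (recip q - 1) = 1.
  by rewrite -powRD ?(gt_eqF C0) ?implybT// addrA subrK subrr powRr0.
by rewrite le_eqVlt; apply/orP; left; apply/eqP; ring: CC.
Qed.
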